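(* Let $\rho>0$ and let $l$ and $r$ be co-prime natural numbers such that $r<2l<\sqrt2\,r$ holds. Then, for every fixed natural number $n\ge3$, there exists a closed $p$-elastic curve with nonconstant curvature in $\mathbb{S}^2(\rho)$, with $p=(n-2)/(n+1)$. Moreover, this curve winds around the pole $l$ times and has $r$ lobes.
   Context: $\mathbb{S}^2(\rho)\subset\mathbb{R}^3$ is the round sphere $x_1^2+x_2^2+x_3^2=1/\rho$ of constant curvature $\rho$. A $p$-elastic curve is an arc length parametrized curve whose (signed, here positive) curvature $\kappa(s)$ satisfies the Euler-Lagrange equation of $\int_\gamma\kappa^p$, namely $(p\kappa^{p-1})_{ss}+p\kappa^{p-1}(\kappa^2+\rho)-\kappa^{p+1}=0$, regardless of boundary conditions. If $\kappa$ is nonconstant this has the first integral $$\kappa_s^2=\frac{\kappa^2}{p^2(1-p)^2}\left(d\,\kappa^{2(1-p)}-(1-p)^2\kappa^2-\rho\,p^2\right)$$ for a constant $d>0$, and, after a rigid motion, the first coordinate of the curve is $x_1(s)=\frac{p}{\sqrt d}\,\kappa(s)^{p-1}$. In these coordinates, the pole is the point $(1/\sqrt\rho,0,0)$, through which the curve never passes. The curve winds around the pole $l$ times if the projection $(x_2,x_3)$ of the closed curve to the plane $x_1=0$ has winding number $l$ (up to orientation) around $(0,0)$. The number of lobes $r$ is the number of periods of the curvature contained in one period of the curve. *)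

(* Defs.v *)
From Stdlib Require Import Reals ZArith.
From Coquelicot Require Import Coquelicot.
Open Scope R_scope.

Definition curve := R -> R * R * R.

Definition x1 (g : curve) (s : R) : R := fst (fst (g s)).
Definition x2 (g : curve) (s : R) : R := snd (fst (g s)).
Definition x3 (g : curve) (s : R) : R := snd (g s).

(* Coquelicot's [ex_derive_n f 2 s] only says that [Derive f] is differentiable
   at [s], so differentiability of [f] itself is stated separately. *)
Definition twice_differentiable (f : R -> R) : Prop :=
  forall s, ex_derive f s /\ ex_derive (Derive f) s.

Definition on_sphere (rho : R) (g : curve) : Prop :=
  forall s, x1 g s ^ 2 + x2 g s ^ 2 + x3 g s ^ 2 = 1 / rho.

Definition arc_length_parametrized (g : curve) : Prop :=
  twice_differentiable (x1 g) /\ twice_differentiable (x2 g) /\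
  twice_differentiable (x3 g) /\
  forall s, Derive (x1 g) s ^ 2 + Derive (x2 g) s ^ 2 + Derive (x3 g) s ^ 2 = 1.

Definition det3 (a1 a2 a3 b1 b2 b3 c1 c2 c3 : R) : R :=
  a1 * (b2 * c3 - b3 * c2) - a2 * (b1 * c3 - b3 * c1) + a3 * (b1 * c2 - b2 * c1).

(* Signed geodesic curvature of an arc length parametrized curve in the sphere
   of curvature [rho]: with T = g' and the unit conormal N = sqrt rho * (g x T),
   one has g'' = kappa N - rho g, so kappa = <g'', N> = sqrt rho * det (g, g', g''). *)
Definition geodesic_curvature (rho : R) (g : curve) (s : R) : R :=
  sqrt rho *
  det3 (x1 g s) (x2 g s) (x3 g s)
       (Derive (x1 g) s) (Derive (x2 g) s) (Derive (x3 g) s)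
       (Derive_n (x1 g) 2 s) (Derive_n (x2 g) 2 s) (Derive_n (x3 g) 2 s).

Definition euler_lagrange (rho p : R) (kappa : R -> R) : Prop :=
  let mu := fun s => p * Rpower (kappa s) (p - 1) in
  twice_differentiable mu /\
  forall s, Derive_n mu 2 s + mu s * (kappa s ^ 2 + rho)
            - Rpower (kappa s) (p + 1) = 0.

(* Positivity of the curvature makes [Rpower] the genuine real power.  Only the
   derivatives that occur are required to exist; for p different from 0 and 1,
   smoothness follows from the equation. *)
Definition p_elastic (rho p : R) (g : curve) : Prop :=
  on_sphere rho g /\ arc_length_parametrized g /\
  (forall s, 0 < geodesic_curvature rho g s) /\
  euler_lagrange rho p (geodesic_curvature rho g).

Definition nonconstant (f : R -> R) : Prop := exists s t, f s <> f t.

Definition first_integral (rho p d : R) (kappa : R -> R) : Prop :=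
  forall s, ex_derive kappa s /\
    Derive kappa s ^ 2 =
      kappa s ^ 2 / (p ^ 2 * (1 - p) ^ 2) *
      (d * Rpower (kappa s) (2 * (1 - p)) - (1 - p) ^ 2 * kappa s ^ 2 - rho * p ^ 2).

(* The curve is positioned by a rigid motion so that the pole determined by it
   is (1 / sqrt rho, 0, 0). *)
Definition in_pole_coordinates (rho p : R) (g : curve) : Prop :=
  exists d, 0 < d /\
    first_integral rho p d (geodesic_curvature rho g) /\
    forall s, x1 g s = p / sqrt d * Rpower (geodesic_curvature rho g s) (p - 1).

Definition period {A : Type} (f : R -> A) (T : R) : Prop :=
  0 < T /\ forall s, f (s + T) = f s.

Definition least_period {A : Type} (f : R -> A) (T : R) : Prop :=
  period f T /\ forall T', period f T' -> T <= T'.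

(* [w] is the winding number around (0,0) of the closed plane curve (x,y) on
   [0,L], through a continuous determination of the polar angle. *)
Definition winding_number (x y : R -> R) (L : R) (w : Z) : Prop :=
  exists theta : R -> R,
    (forall s, continuous theta s) /\
    (forall s, 0 <= s <= L ->
       (x s, y s) <> (0, 0) /\
       x s = sqrt (x s ^ 2 + y s ^ 2) * cos (theta s) /\
       y s = sqrt (x s ^ 2 + y s ^ 2) * sin (theta s)) /\
    theta L - theta 0 = 2 * PI * IZR w.

Definition winds_around_pole (g : curve) (L : R) (l : nat) : Prop :=
  exists w : Z, Z.abs w = Z.of_nat l /\ winding_number (x2 g) (x3 g) L w.

Definition has_lobes (rho : R) (g : curve) (L : R) (r : nat) : Prop :=
  exists T, least_period (geodesic_curvature rho g) T /\ L = INR r * T.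

(* Main.v *)
Require Import Defs.
From Stdlib Require Import Reals ZArith Lra Lia ClassicalEpsilon.
From Coquelicot Require Import Coquelicot.
Open Scope R_scope.

(* Put q = p / (1 - p) = (n - 2) / 3 and k = sqrt rho.  The Euler-Lagrange equation makes
   v ~ kappa^(p-1) a Newtonian motion v' = k a, a' = -k (v - v^(-2q-1)) with energy
   a^2 + v^2 + z^2 = B^2, where z = v^(-q) / sqrt q.  This energy identity says that
   (v, (a + iz) e^(i th)) / (k B) runs on the sphere of curvature k^2; with
   th' = k z (1 / (B + v) + q / v) it has unit speed and curvature kappa = k q z / v.
   Since z > 0, arg (a + iz) stays in (0, pi), so the curve turns around the pole by the increment
   Lambda of th over one period of v.  Written as an integral over the phase of the oscillation
   of amplitude A = sqrt (B^2 - 1 - 1/q), Lambda depends continuously on A, equals sqrt 2 * pi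
   at A = 0, and its upper limit as A tends to infinity is at most pi.  The intermediate value
   theorem gives Lambda = 2 pi l / r, so the curve closes up exactly after r periods. *)

(** * Continuity rules and differentiable inverses *)

Lemma is_derive_continuous (f : R -> R) (x l : R) :
  is_derive f x l -> continuous f x.
Proof.
  intros H; apply (ex_derive_continuous f); exists l; exact H.
Qed.

Lemma continuous_Rplus {U : UniformSpace} (f g : U -> R) (x : U) :
  continuous f x -> continuous g x -> continuous (fun t => f t + g t) x.
Proof. apply (continuous_plus (V := R_NormedModule)). Qed.

Lemma continuous_Rminus {U : UniformSpace} (f g : U -> R) (x : U) :
  continuous f x -> continuous g x -> continuous (fun t => f t - g t) x.
Proof. apply (continuous_minus (V := R_NormedModule)). Qed.

Lemma continuous_Rmult {U : UniformSpace} (f g : U -> R) (x : U) :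
  continuous f x -> continuous g x -> continuous (fun t => f t * g t) x.
Proof. apply (continuous_mult (K := R_AbsRing)). Qed.

Lemma continuous_Rdiv {U : UniformSpace} (f g : U -> R) (x : U) :
  continuous f x -> continuous g x -> g x <> 0 -> continuous (fun t => f t / g t) x.
Proof.
  intros Hf Hg Hx; apply continuous_Rmult; [exact Hf | ].
  apply (continuous_comp g Rinv); [exact Hg | apply continuous_Rinv, Hx].
Qed.

Lemma positive_derivative_lt (f f' : R -> R) :
  (forall x, is_derive f x (f' x)) -> (forall x, 0 < f' x) ->
  forall x y, x < y -> f x < f y.
Proof.
  intros Hf Hpos x y Hxy.
  apply (incr_function f m_infty p_infty f'); simpl; auto.
  intros; apply Rlt_gt, Hpos.
Qed.

(** Serves twice: for the signed root of the potential and for elapsed time as a function of the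
    phase. Preimages come from the intermediate value theorem; strict monotonicity makes the inverse
    unique and continuous, after which the derivative rule for inverses applies. *)
Lemma inverse_function (f f' : R -> R) :
  (forall x, is_derive f x (f' x)) -> (forall x, 0 < f' x) ->
  (forall y, exists a b, f a <= y <= f b) ->
  exists g : R -> R,
    (forall y, f (g y) = y) /\ (forall x, g (f x) = x) /\
    forall y, is_derive g y (/ f' (g y)).
Proof.
  intros Hf Hpos Hsurj.
  pose proof (positive_derivative_lt f f' Hf Hpos) as Hlt.
  assert (Hcont : continuity f).
  { intro x; apply continuity_pt_filterlim; exact (is_derive_continuous _ _ _ (Hf x)). }
  assert (Hle : forall x y, f x <= f y -> x <= y).
  { intros x y H; destruct (Rle_or_lt x y) as [ | C]; auto.
    apply Hlt in C; lra. }
  assert (Hpre : forall y, exists x, f x = y).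
  { intro y; destruct (Hsurj y) as (a & b & Ha & Hb).
    destruct (IVT_gen f a b y Hcont) as (x & _ & Hx); [ | eauto].
    split; [apply Rle_trans with (1 := Rmin_l _ _) | apply Rle_trans with (2 := Rmax_r _ _)]; auto. }
  set (g := fun y => proj1_sig (constructive_indefinite_description _ (Hpre y))).
  assert (Hg : forall y, f (g y) = y).
  { intro y; exact (proj2_sig (constructive_indefinite_description _ (Hpre y))). }
  clearbody g; exists g; split; [exact Hg | ].
  assert (Hgf : forall x, g (f x) = x).
  { intro x; apply Rle_antisym; apply Hle; rewrite Hg; lra. }
  split; [exact Hgf | ].
  assert (Hgc : forall y, continuity_pt g y).
  { intro y; apply continuity_pt_locally; intros [eps Heps]; simpl.
    pose proof (Hlt (g y - eps) (g y) ltac:(lra)) as H1.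
    pose proof (Hlt (g y) (g y + eps) ltac:(lra)) as H2.
    rewrite Hg in H1, H2.
    (* The images of [g y - eps] and [g y + eps] enclose [y]; the smaller of the two gaps serves as
       delta. *)
    assert (Hd : 0 < Rmin (y - f (g y - eps)) (f (g y + eps) - y)) by (apply Rmin_glb_lt; lra).
    exists (mkposreal _ Hd); intros u Hu; apply Rabs_lt_between in Hu.
    simpl in Hu; unfold minus, plus, opp in Hu; simpl in Hu.
    pose proof (Rmin_l (y - f (g y - eps)) (f (g y + eps) - y)).
    pose proof (Rmin_r (y - f (g y - eps)) (f (g y + eps) - y)).
    apply Rabs_lt_between; split.
    - destruct (Rlt_or_le (g y - eps) (g u)) as [ | C]; [lra | ].
      destruct C as [C | C]; [apply Hlt in C; rewrite Hg in C; lra | ].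
      rewrite <- C, Hg in *; lra.
    - destruct (Rlt_or_le (g u) (g y + eps)) as [ | C]; [lra | ].
      destruct C as [C | C]; [apply Hlt in C; rewrite Hg in C; lra | ].
      rewrite C, Hg in *; lra. }
  intro y.
  assert (Hgm : forall u v, u <= v -> g u <= g v).
  { intros u v Huv; apply Hle; rewrite !Hg; exact Huv. }
  (* The derivative rule works over a bounded range of values; [[y - 1, y + 1]] is one around
     [y]. *)
  assert (Hprf : forall a, g (y - 1) <= a <= g (y + 1) -> derivable_pt f a).
  { intros a _; exists (f' a); apply is_derive_Reals, Hf. }
  assert (Hin : g (y - 1) <= g y <= g (y + 1)) by (split; apply Hgm; lra).
  assert (Hder : derive_pt f (g y) (Hprf (g y) Hin) = f' (g y)).
  { apply derive_pt_eq; apply is_derive_Reals, Hf. }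
  apply is_derive_Reals.
  replace (/ f' (g y)) with (1 / derive_pt f (g y) (Hprf (g y) Hin)).
  - apply Ranalysis5.derivable_pt_lim_recip_interv; auto; try lra.
    + intros u _; apply Hg.
    + rewrite Hder; pose proof (Hpos (g y)); lra.
  - rewrite Hder; unfold Rdiv; apply Rmult_1_l.
Qed.

(** * The potential and its energy chart *)

(* [(exp x - 1 - x) / x ^ 2], extended smoothly through [x = 0]: it makes the signed
   square root of the potential differentiable at its minimum. *)
Definition exp_remainder : R -> R :=
  PSeries (PS_decr_n (fun n => / INR (fact n)) 2).

Lemma CV_radius_exp : CV_radius (fun n => / INR (fact n)) = p_infty.
Proof.
  apply CV_radius_infinite_DAlembert.
  - intro n; apply Rinv_neq_0_compat, INR_fact_neq_0.
  - apply is_lim_seq_ext with (fun n => / INR (S n)).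
    + intro n; rewrite Rabs_pos_eq.
      * rewrite fact_simpl, mult_INR; field.
        split; [apply INR_fact_neq_0 | apply not_0_INR; lia].
      * apply Rmult_le_pos; [left; apply Rinv_0_lt_compat, INR_fact_lt_0 | ].
        rewrite Rinv_inv; left; apply INR_fact_lt_0.
    + replace (Finite 0) with (Rbar_inv p_infty) by reflexivity.
      apply is_lim_seq_inv; [ | discriminate].
      apply (is_lim_seq_incr_1 INR), is_lim_seq_INR.
Qed.

Lemma CV_radius_exp_remainder :
  CV_radius (PS_decr_n (fun n => / INR (fact n)) 2) = p_infty.
Proof.
  rewrite <- CV_radius_exp.
  rewrite <- (CV_radius_decr_1 (fun n => / INR (fact n))).
  rewrite <- (CV_radius_decr_1 (PS_decr_1 (fun n => / INR (fact n)))).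
  reflexivity.
Qed.

Lemma exp_remainder_eq (x : R) : x ^ 2 * exp_remainder x = exp x - 1 - x.
Proof.
  rewrite exp_Reals, (PSeries_decr_n _ 1).
  - unfold exp_remainder; simpl; field.
  - exists (exp x); apply is_exp_Reals.
Qed.

Lemma exp_remainder_0 : exp_remainder 0 = / 2.
Proof.
  unfold exp_remainder; rewrite PSeries_0; unfold PS_decr_n; simpl; f_equal; lra.
Qed.

Lemma exp_remainder_pos (x : R) : 0 < exp_remainder x.
Proof.
  destruct (Req_dec x 0) as [-> | Hx]; [rewrite exp_remainder_0; lra | ].
  pose proof (exp_remainder_eq x); pose proof (exp_ineq1 x Hx).
  assert (0 < x ^ 2) by (apply pow2_gt_0; exact Hx).
  apply Rmult_lt_reg_l with (x ^ 2); lra.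
Qed.

(** Continuity of the derivative is what makes [dcoord], and hence the integrands built from it,
    continuous. *)
Lemma exp_remainder_C1 :
  exists e, (forall x, is_derive exp_remainder x (e x)) /\ forall x, continuous e x.
Proof.
  exists (PSeries (PS_derive (PS_decr_n (fun n => / INR (fact n)) 2))); split; intro x.
  - apply is_derive_PSeries; rewrite CV_radius_exp_remainder; exact I.
  - apply continuity_pt_filterlim, PSeries_continuity.
    rewrite CV_radius_derive, CV_radius_exp_remainder; exact I.
Qed.

(* With [v = exp y] this is [v^2 + v^(-2q) / q], normalised to vanish at its minimum [v = 1]. *)
Definition potential (q y : R) : R := exp (2 * y) + exp (- (2 * q) * y) / q - 1 - 1 / q.

Lemma is_derive_potential (q y : R) : 0 < q ->
  is_derive (potential q) y (2 * (exp (2 * y) - exp (- (2 * q) * y))).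
Proof. intros Hq; unfold potential; auto_derive; [lra | field; lra]. Qed.

(* The inverse of the signed square root of the potential: in the coordinate [w] the
   energy level is the circle [a^2 + w^2 = A^2], so an orbit is parametrized by an angle. *)
Record chart (q : R) := {
  coord : R -> R;
  dcoord : R -> R;
  is_derive_coord : forall w, is_derive coord w (dcoord w);
  continuous_dcoord : forall w, continuous dcoord w;
  dcoord_gt_0 : forall w, 0 < dcoord w;
  potential_coord : forall w, potential q (coord w) = w ^ 2;
  dcoord_eq : forall w, dcoord w * (exp (2 * coord w) - exp (- (2 * q) * coord w)) = w;
  coord_0 : coord 0 = 0;
  dcoord_0 : 2 * (q + 1) * dcoord 0 ^ 2 = 1;
  coord_unbounded : forall M, exists w, coord w = M
}.

Arguments coord {q}.
Arguments dcoord {q}.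

(** The linear terms of the two exponentials cancel, so the potential is [y ^ 2 * K y] with [K]
    positive, and [W = y * sqrt K] is a signed root of it. [W'] is positive: off 0 because [W] and
    the derivative [2 * W * W'] of the potential have the same sign, at 0 because it equals
    [sqrt (K 0)]. The chart is the inverse of [W]. *)
Lemma chart_exists (q : R) : 0 < q -> inhabited (chart q).
Proof.
  intros Hq.
  destruct exp_remainder_C1 as (e & He & Hec).
  set (K := fun y => 4 * exp_remainder (2 * y) + 4 * q * exp_remainder (- (2 * q) * y)).
  set (K' := fun y => 8 * e (2 * y) - 8 * q ^ 2 * e (- (2 * q) * y)).
  assert (HK : forall y, is_derive K y (K' y)).
  { intro y; unfold K, K'; auto_derive.
    - repeat split; eexists; apply He.
    - rewrite (is_derive_unique _ _ _ (He _)), (is_derive_unique _ _ _ (He _)); ring. }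
  assert (HKpos : forall y, 0 < K y).
  { intro y; unfold K.
    pose proof (exp_remainder_pos (2 * y)).
    pose proof (exp_remainder_pos (- (2 * q) * y)).
    assert (0 < 4 * q * exp_remainder (- (2 * q) * y)) by (repeat apply Rmult_lt_0_compat; lra).
    lra. }
  assert (HKeq : forall y, y ^ 2 * K y = potential q y).
  { intro y; unfold K, potential.
    replace (y ^ 2 * _) with ((2 * y) ^ 2 * exp_remainder (2 * y)
      + (- (2 * q) * y) ^ 2 * exp_remainder (- (2 * q) * y) / q) by (field; lra).
    rewrite !exp_remainder_eq; field; lra. }
  set (W := fun y => y * sqrt (K y)).
  set (W' := fun y => sqrt (K y) + y * (K' y / (2 * sqrt (K y)))).
  assert (HW : forall y, is_derive W y (W' y)).
  { intro y; unfold W, W'; auto_derive.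
    - repeat split; [eexists; apply HK | apply HKpos].
    - rewrite (is_derive_unique _ _ _ (HK _)).
      assert (0 < sqrt (K y)) by apply sqrt_lt_R0, HKpos; field; lra. }
  assert (HW2 : forall y, W y ^ 2 = potential q y).
  { intro y; unfold W; rewrite Rpow_mult_distr, pow2_sqrt; [apply HKeq | left; apply HKpos]. }
  assert (HWW' : forall y, W' y * W y = exp (2 * y) - exp (- (2 * q) * y)).
  { intro y.
    assert (H : is_derive (fun y => W y ^ 2) y (2 * (W' y * W y))).
    { auto_derive; [eexists; apply HW | rewrite (is_derive_unique _ _ _ (HW _)); ring]. }
    apply (is_derive_ext _ (potential q)) in H; [ | exact HW2].
    pose proof (is_derive_unique _ _ _ H) as E1.
    pose proof (is_derive_unique _ _ _ (is_derive_potential q y Hq)) as E2.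
    lra. }
  assert (HW0 : W' 0 = sqrt (K 0)) by (unfold W'; ring).
  assert (HWpos : forall y, 0 < W' y).
  { intro y; destruct (Rtotal_order y 0) as [Hy | [Hy | Hy]].
    - assert (W y < 0).
      { unfold W; pose proof (sqrt_lt_R0 _ (HKpos y)); nra. }
      assert (exp (2 * y) < exp (- (2 * q) * y)) by (apply exp_increasing; nra).
      pose proof (HWW' y); nra.
    - rewrite Hy, HW0; apply sqrt_lt_R0, HKpos.
    - assert (0 < W y).
      { unfold W; pose proof (sqrt_lt_R0 _ (HKpos y)); nra. }
      assert (exp (- (2 * q) * y) < exp (2 * y)) by (apply exp_increasing; nra).
      pose proof (HWW' y); nra. }
  assert (HWc : forall y, continuous W' y).
  { intro y.
    assert (CK : continuous K y) by exact (is_derive_continuous _ _ _ (HK y)).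
    assert (CK' : continuous K' y).
    { unfold K'; apply continuous_Rminus; apply continuous_Rmult;
        [apply continuous_const | | apply continuous_const | ].
      - apply (continuous_comp (fun y => 2 * y) e); [ | apply Hec].
        apply continuous_Rmult; [apply continuous_const | apply continuous_id].
      - apply (continuous_comp (fun y => - (2 * q) * y) e); [ | apply Hec].
        apply continuous_Rmult; [apply continuous_const | apply continuous_id]. }
    assert (CS : continuous (fun y => sqrt (K y)) y).
    { apply (continuous_comp K sqrt); [exact CK | apply continuous_sqrt]. }
    pose proof (sqrt_lt_R0 _ (HKpos y)).
    unfold W'; apply continuous_Rplus; [exact CS | ].
    apply continuous_Rmult; [apply continuous_id | ].
    apply continuous_Rdiv; [exact CK' | | lra].
    apply continuous_Rmult; [apply continuous_const | exact CS]. }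
  (* At either witness the bound [exp x >= 1 + x] gives [W ^ 2 >= w ^ 2], and the sign of [W] there
     is known. *)
  assert (Hsurj : forall w, exists a b, W a <= w <= W b).
  { assert (Hbig : forall w, exists b, 0 <= b /\ w <= W b).
    { intro w; exists (w ^ 2 + 1 + 1 / q).
      assert (0 < 1 / q) by (apply Rdiv_lt_0_compat; lra).
      set (b := w ^ 2 + 1 + 1 / q); assert (Hb : 0 <= b) by (unfold b; nra).
      split; [exact Hb | ].
      assert (0 <= W b) by (unfold W; apply Rmult_le_pos; [exact Hb | apply sqrt_pos]).
      pose proof (HW2 b) as E; unfold potential in E.
      pose proof (exp_ineq1_le (2 * b)).
      assert (0 < exp (- (2 * q) * b) / q) by (apply Rdiv_lt_0_compat; [apply exp_pos | lra]).
      unfold b in *; nra. }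
    assert (Hsmall : forall w, exists a, W a <= w).
    { intro w; exists (- (w ^ 2 + 1)).
      set (a := - (w ^ 2 + 1)); assert (Ha : a <= 0) by (unfold a; nra).
      assert (W a <= 0) by (unfold W; pose proof (sqrt_pos (K a)); nra).
      pose proof (HW2 a) as E; unfold potential in E.
      pose proof (exp_pos (2 * a)).
      assert (- (2 * a) + 1 / q <= exp (- (2 * q) * a) / q).
      { replace (- (2 * a) + 1 / q) with ((1 + - (2 * q) * a) / q) by (field; lra).
        apply Rmult_le_compat_r; [left; apply Rinv_0_lt_compat, Hq | apply exp_ineq1_le]. }
      unfold a in *; nra. }
    intro w; destruct (Hbig w) as (b & _ & Hb); destruct (Hsmall w) as (a & Ha); eauto. }
  destruct (inverse_function W W' HW HWpos Hsurj) as (Y & HY1 & HY2 & HY3).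
  assert (HY0 : Y 0 = 0).
  { rewrite <- (HY2 0) at 2; f_equal; unfold W; ring. }
  constructor.
  refine {| coord := Y; dcoord := fun w => / W' (Y w) |}.
  - exact HY3.
  - intro w; apply (continuous_comp (fun w => W' (Y w)) Rinv).
    + apply (continuous_comp Y W'); [exact (is_derive_continuous _ _ _ (HY3 w)) | apply HWc].
    + apply continuous_Rinv; pose proof (HWpos (Y w)); lra.
  - intro w; apply Rinv_0_lt_compat, HWpos.
  - intro w; rewrite <- HW2, HY1; reflexivity.
  - intro w; rewrite <- HWW', HY1; pose proof (HWpos (Y w)); field; lra.
  - exact HY0.
  - rewrite HY0, HW0, pow_inv, pow2_sqrt by (left; apply HKpos).
    unfold K; replace (2 * 0) with 0 by ring; replace (- (2 * q) * 0) with 0 by ring.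
    rewrite exp_remainder_0; field; lra.
  - intro M; exists (W M); apply HY2.
Qed.

(** * The angle swept during one oscillation *)

(* Bernoulli's inequality [m^(q+2) >= 1 + (q+2)(m-1)] for [m = exp x]. *)
Lemma exp_tangent (q x : R) : 0 < q -> (q + 2) * exp x <= exp ((q + 2) * x) + (q + 1).
Proof.
  intros Hq.
  assert (H : q + 2 <= exp ((q + 1) * x) + (q + 1) * exp (- x)).
  { pose proof (exp_ineq1_le ((q + 1) * x)); pose proof (exp_ineq1_le (- x)).
    assert ((q + 1) * (1 + - x) <= (q + 1) * exp (- x)) by (apply Rmult_le_compat_l; lra).
    lra. }
  apply Rmult_le_compat_r with (r := exp x) in H; [ | left; apply exp_pos].
  replace ((exp ((q + 1) * x) + (q + 1) * exp (- x)) * exp x)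
    with (exp ((q + 1) * x) * exp x + (q + 1) * (exp (- x) * exp x)) in H by ring.
  rewrite <- !exp_plus in H.
  replace ((q + 1) * x + x) with ((q + 2) * x) in H by ring.
  rewrite Rplus_opp_l, exp_0 in H; lra.
Qed.

(** Write m = exp (2 y) and t = exp (-2 q y) at y = [coord C w]. As [dcoord] is w / (m - t) and w^2
    is the potential, the claim off w = 0 becomes t ((q+2) m - (q+1)) <= m^2. This is [exp_tangent]
    multiplied by t, because t m^(q+2) = m^2. At w = 0 the known value of [dcoord] is used. *)
Lemma dcoord_bound_left (q : R) (C : chart q) (w : R) : 0 < q ->
  q * exp (- (2 * q) * coord C w) * dcoord C w ^ 2 <= 1.
Proof.
  intros Hq.
  pose proof (dcoord_eq q C w) as H1; pose proof (potential_coord q C w) as H2.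
  pose proof (exp_tangent q (2 * coord C w) Hq) as H3; unfold potential in H2.
  assert (H4 : exp ((q + 2) * (2 * coord C w)) * exp (- (2 * q) * coord C w) = exp (2 * coord C w) ^ 2).
  { simpl; rewrite Rmult_1_r, <- !exp_plus; f_equal; ring. }
  destruct (Req_dec (exp (2 * coord C w) - exp (- (2 * q) * coord C w)) 0) as [E | E].
  - assert (Hw : w = 0) by (rewrite E in H1; lra).
    subst w; rewrite coord_0; pose proof (dcoord_0 q C).
    replace (- (2 * q) * 0) with 0 by ring; rewrite exp_0; nra.
  - pose proof (exp_pos (- (2 * q) * coord C w)) as Ht.
    set (m := exp (2 * coord C w)) in *; set (t := exp (- (2 * q) * coord C w)) in *.
    set (u := exp ((q + 2) * (2 * coord C w))) in *.
    assert (Hs : 0 < (m - t) ^ 2) by (apply pow2_gt_0; exact E).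
    apply Rmult_le_reg_r with ((m - t) ^ 2); [exact Hs | ].
    replace (q * t * dcoord C w ^ 2 * (m - t) ^ 2) with (q * t * (dcoord C w * (m - t)) ^ 2) by ring.
    rewrite H1, <- H2.
    replace (q * t * (m + t / q - 1 - 1 / q)) with (t * ((q + 2) * m - (q + 1)) + (t ^ 2 - 2 * m * t))
      by (field; lra).
    assert (t * ((q + 2) * m - (q + 1)) <= t * u) by (apply Rmult_le_compat_l; lra).
    nra.
Qed.

(** Mirror image of [dcoord_bound_left]: m and t change places and q becomes 1 / q. *)
Lemma dcoord_bound_right (q : R) (C : chart q) (w : R) : 0 < q ->
  exp (2 * coord C w) * dcoord C w ^ 2 <= 1.
Proof.
  intros Hq.
  pose proof (dcoord_eq q C w) as H1; pose proof (potential_coord q C w) as H2.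
  assert (Hq' : 0 < 1 / q) by (apply Rdiv_lt_0_compat; lra).
  pose proof (exp_tangent (1 / q) (- (2 * q) * coord C w) Hq') as H3; unfold potential in H2.
  assert (H4 : exp ((1 / q + 2) * (- (2 * q) * coord C w)) * exp (2 * coord C w)
    = exp (- (2 * q) * coord C w) ^ 2).
  { simpl; rewrite Rmult_1_r, <- !exp_plus; f_equal; field; lra. }
  destruct (Req_dec (exp (2 * coord C w) - exp (- (2 * q) * coord C w)) 0) as [E | E].
  - assert (Hw : w = 0) by (rewrite E in H1; lra).
    subst w; rewrite coord_0; pose proof (dcoord_0 q C).
    replace (2 * 0) with 0 by ring; rewrite exp_0; nra.
  - pose proof (exp_pos (2 * coord C w)) as Hm.
    set (m := exp (2 * coord C w)) in *; set (t := exp (- (2 * q) * coord C w)) in *.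
    set (u := exp ((1 / q + 2) * (- (2 * q) * coord C w))) in *.
    assert (Hs : 0 < (m - t) ^ 2) by (apply pow2_gt_0; exact E).
    apply Rmult_le_reg_r with ((m - t) ^ 2); [exact Hs | ].
    replace (m * dcoord C w ^ 2 * (m - t) ^ 2) with (m * (dcoord C w * (m - t)) ^ 2) by ring.
    rewrite H1, <- H2.
    replace (m * (m + t / q - 1 - 1 / q))
      with (m * ((1 / q + 2) * t - (1 / q + 1)) + (m ^ 2 - 2 * m * t)) by (field; lra).
    assert (m * ((1 / q + 2) * t - (1 / q + 1)) <= m * u) by (apply Rmult_le_compat_l; lra).
    nra.
Qed.

Lemma coord_le (q : R) (C : chart q) (w w' : R) : w <= w' -> coord C w <= coord C w'.
Proof.
  intros [H | ->]; [left | right; reflexivity].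
  exact (positive_derivative_lt _ _ (is_derive_coord q C) (dcoord_gt_0 q C) _ _ H).
Qed.

Lemma continuous_coord (q : R) (C : chart q) (w : R) : continuous (coord C) w.
Proof. exact (is_derive_continuous _ _ _ (is_derive_coord q C w)). Qed.

Lemma continuous_exp_scal_coord (q c : R) (C : chart q) (w : R) :
  continuous (fun w => exp (c * coord C w)) w.
Proof.
  apply (continuous_comp (fun w => c * coord C w) exp).
  - apply continuous_Rmult; [apply continuous_const | apply continuous_coord].
  - exact (is_derive_continuous _ _ _ (is_derive_exp _)).
Qed.

(* Derivative of the rotation angle [th] with respect to the phase [t], at [w = A sin t].
   The remaining part [arg (a + iz)] of the polar angle has been split off: it contributes
   nothing over a period, and its removal leaves no small denominators. *)
Definition turning_rate {q : R} (C : chart q) (B w : R) : R :=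
  exp (- q * coord C w) * dcoord C w / sqrt q * (exp (coord C w) / (B + exp (coord C w)) + q).

(** By [dcoord_bound_left], q times this factor of [turning_rate] has square at most 1. The bound
    does not depend on the amplitude. *)
Lemma turning_weight_bound (q : R) (C : chart q) (w : R) : 0 < q ->
  0 <= exp (- q * coord C w) * dcoord C w / sqrt q <= 1 / q.
Proof.
  intros Hq; pose proof (sqrt_lt_R0 q Hq) as Hs.
  assert (H0 : 0 < exp (- q * coord C w) * dcoord C w / sqrt q).
  { apply Rdiv_lt_0_compat; [ | exact Hs].
    apply Rmult_lt_0_compat; [apply exp_pos | apply dcoord_gt_0]. }
  split; [lra | ].
  pose proof (dcoord_bound_left q C w Hq) as H.
  replace (- (2 * q) * coord C w) with (- q * coord C w + - q * coord C w) in H by ring.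
  rewrite exp_plus in H.
  set (x := exp (- q * coord C w) * dcoord C w / sqrt q) in *.
  assert (Hx : x * sqrt q = exp (- q * coord C w) * dcoord C w) by (unfold x; field; lra).
  assert (Hx2 : (q * x) ^ 2 <= 1).
  { replace ((q * x) ^ 2) with (q * (x * sqrt q) ^ 2).
    - rewrite Hx; nra.
    - rewrite Rpow_mult_distr, pow2_sqrt by lra; ring. }
  apply Rmult_le_reg_l with q; [exact Hq | ].
  replace (q * (1 / q)) with 1 by (field; lra).
  assert (0 <= q * x) by (apply Rmult_le_pos; lra).
  nra.
Qed.

Lemma ratio_bound (B v : R) : 0 < B -> 0 < v -> 0 < v / (B + v) <= 1 /\ v / (B + v) <= v / B.
Proof.
  intros HB Hv; assert (H : 0 < / (B + v)) by (apply Rinv_0_lt_compat; lra).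
  split; [split | ].
  - apply Rdiv_lt_0_compat; lra.
  - apply Rmult_le_reg_r with (B + v); [lra | ]; field_simplify; lra.
  - apply Rmult_le_compat_l; [lra | apply Rinv_le_contravar; lra].
Qed.

(** A crude uniform bound, for the short phase intervals where neither of the next two estimates is
    effective. *)
Lemma turning_rate_le (q : R) (C : chart q) (B w : R) : 0 < q -> 0 < B ->
  turning_rate C B w <= 1 / q * (1 + q).
Proof.
  intros Hq HB; pose proof (turning_weight_bound q C w Hq).
  pose proof (ratio_bound B _ HB (exp_pos (coord C w))).
  apply Rmult_le_compat; lra.
Qed.

(** Here v <= 1, so v / (B + v) <= 1 / B. For large B the bound tends to 1, and this half period
    contributes at most about pi. *)
Lemma turning_rate_le_neg (q : R) (C : chart q) (B w : R) : 0 < q -> 0 < B -> w <= 0 ->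
  turning_rate C B w <= 1 + / (q * B).
Proof.
  intros Hq HB Hw; pose proof (turning_weight_bound q C w Hq).
  pose proof (ratio_bound B _ HB (exp_pos (coord C w))).
  assert (exp (coord C w) / B <= 1 / B).
  { apply Rmult_le_compat_r; [left; apply Rinv_0_lt_compat, HB | ].
    pose proof (coord_le q C w 0 Hw) as Hp; rewrite coord_0 in Hp.
    rewrite <- exp_0; destruct Hp as [Hp | ->]; [left; apply exp_increasing, Hp | right; reflexivity]. }
  apply Rle_trans with (1 / q * (1 / B + q)).
  - apply Rmult_le_compat; lra.
  - right; field; lra.
Qed.

(** Here v >= 1, so [dcoord_bound_right] gives [dcoord <= 1]; the remaining factor v^(-q) makes this
    half period negligible for large amplitudes. *)
Lemma turning_rate_le_pos (q : R) (C : chart q) (B w : R) : 0 < q -> 0 < B -> 0 <= w ->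
  turning_rate C B w <= exp (- q * coord C w) / sqrt q * (1 + q).
Proof.
  intros Hq HB Hw; pose proof (turning_weight_bound q C w Hq) as H.
  pose proof (ratio_bound B _ HB (exp_pos (coord C w))).
  assert (HD : dcoord C w <= 1).
  { pose proof (dcoord_bound_right q C w Hq); pose proof (dcoord_gt_0 q C w).
    pose proof (coord_le q C 0 w Hw) as Hp; rewrite coord_0 in Hp.
    pose proof (exp_ineq1_le (2 * coord C w)).
    assert (0 <= (exp (2 * coord C w) - 1) * dcoord C w ^ 2)
      by (apply Rmult_le_pos; [lra | apply pow2_ge_0]).
    nra. }
  apply Rmult_le_compat; try lra.
  apply Rmult_le_compat_r; [left; apply Rinv_0_lt_compat, sqrt_lt_R0, Hq | ].
  pose proof (exp_pos (- q * coord C w)); nra.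
Qed.

Lemma continuous_turning_rate (q : R) (C : chart q) (B w : R) : 0 < B ->
  continuous (fun x : R * R => turning_rate C (fst x) (snd x)) (B, w).
Proof.
  intros HB; unfold turning_rate.
  assert (HE : forall c, continuous (fun x : R * R => exp (c * coord C (snd x))) (B, w)).
  { intro c; apply (continuous_comp snd (fun w => exp (c * coord C w)));
      [apply continuous_snd | apply continuous_exp_scal_coord]. }
  assert (HE1 : continuous (fun x : R * R => exp (coord C (snd x))) (B, w)).
  { apply continuous_ext with (2 := HE 1); intro x; f_equal; ring. }
  repeat apply continuous_Rmult; try apply continuous_const.
  - apply HE.
  - apply (continuous_comp snd (dcoord C)); [apply continuous_snd | apply continuous_dcoord].
  - apply continuous_Rplus; [ | apply continuous_const].
    apply continuous_Rdiv; [exact HE1 | | ].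
    + apply continuous_Rplus; [apply continuous_fst | exact HE1].
    + simpl; pose proof (exp_pos (coord C w)); lra.
Qed.

Definition radius (q A : R) : R := sqrt (A ^ 2 + 1 + 1 / q).

Lemma radius_pos (q A : R) : 0 < q -> 0 < radius q A.
Proof.
  intros Hq; apply sqrt_lt_R0.
  assert (0 < 1 / q) by (apply Rdiv_lt_0_compat; lra); nra.
Qed.

Lemma radius_sqr (q A : R) : 0 < q -> radius q A ^ 2 = A ^ 2 + 1 + 1 / q.
Proof.
  intros Hq; apply pow2_sqrt.
  assert (0 < 1 / q) by (apply Rdiv_lt_0_compat; lra); nra.
Qed.

Definition turning {q : R} (C : chart q) (A t : R) : R :=
  turning_rate C (radius q A) (A * sin t).

Lemma continuous_turning_2d (q : R) (C : chart q) (A t : R) : 0 < q ->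
  continuous (fun x : R * R => turning C (fst x) (snd x)) (A, t).
Proof.
  intros Hq; unfold turning.
  apply (continuous_comp_2 (fun x : R * R => radius q (fst x))
    (fun x : R * R => fst x * sin (snd x)) (turning_rate C)).
  - unfold radius.
    apply (continuous_comp (fun x : R * R => fst x ^ 2 + 1 + 1 / q) sqrt);
      [ | apply continuous_sqrt].
    repeat apply continuous_Rplus; try apply continuous_const.
    repeat apply continuous_Rmult; try apply continuous_const; apply continuous_fst.
  - apply continuous_Rmult; [apply continuous_fst | ].
    apply (continuous_comp snd sin); [apply continuous_snd | apply continuous_sin].
  - apply continuous_turning_rate; apply radius_pos, Hq.
Qed.

Lemma continuous_turning (q : R) (C : chart q) (A t : R) : 0 < q -> continuous (turning C A) t.
Proof.
  intros Hq.
  apply (continuous_comp_2 (fun _ => A) (fun t => t) (turning C)).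
  - apply continuous_const.
  - apply continuous_id.
  - apply continuous_turning_2d, Hq.
Qed.

Lemma ex_RInt_turning (q : R) (C : chart q) (A a b : R) : 0 < q -> ex_RInt (turning C A) a b.
Proof.
  intros Hq; apply (ex_RInt_continuous (V := R_CompleteNormedModule)).
  intros t _; apply continuous_turning, Hq.
Qed.

Definition advance {q : R} (C : chart q) (A : R) : R := RInt (turning C A) 0 (2 * PI).

(** Joint continuity of [turning] is uniform in the phase over the compact interval [0, 2 pi]; a
    tolerance eps / (4 pi) on the integrand costs eps / 2 on the integral. *)
Lemma continuity_advance (q : R) (C : chart q) : 0 < q -> continuity (advance C).
Proof.
  intros Hq A; apply continuity_pt_locally; intros eps.
  assert (Hpi := PI_RGT_0).
  assert (He : 0 < eps / (4 * PI)) by (apply Rdiv_lt_0_compat; [apply cond_pos | lra]).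
  destruct (uniform_continuity_2d_1d' (turning C) 0 (2 * PI) A) with (eps := mkposreal _ He)
    as (delta & Hd).
  { intros t _; apply continuity_2d_pt_filterlim; exact (continuous_turning_2d q C A t Hq). }
  exists delta; intros A' HA'; apply Rabs_lt_between in HA'.
  unfold minus, plus, opp in HA'; simpl in HA'.
  pose proof (cond_pos delta).
  unfold advance.
  rewrite <- (RInt_minus (V := R_CompleteNormedModule) (turning C A') (turning C A))
    by (apply ex_RInt_turning, Hq).
  apply Rle_lt_trans with ((2 * PI - 0) * (eps / (4 * PI))).
  - apply (abs_RInt_le_const (fun t => minus (turning C A' t) (turning C A t))); [lra | | ].
    + apply (ex_RInt_minus (V := R_NormedModule)); apply ex_RInt_turning, Hq.
    + intros t Ht; left; apply Hd; try lra.
      rewrite Rminus_diag, Rabs_R0; apply cond_pos.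
  - pose proof (cond_pos eps); replace ((2 * PI - 0) * (eps / (4 * PI))) with (eps / 2) by (field; lra).
    lra.
Qed.

(** At zero amplitude the integrand is constant. From q B^2 = q + 1 the bracket 1 / (B + 1) + q
    equals q B, and [dcoord_0] then gives the square of the integrand as 1/2. *)
Lemma advance_0 (q : R) (C : chart q) : 0 < q -> advance C 0 = sqrt 2 * PI.
Proof.
  intros Hq; unfold advance.
  rewrite (RInt_ext _ (fun _ => sqrt 2 / 2)).
  - rewrite RInt_const; unfold scal; simpl; unfold mult; simpl; field.
  - intros t _; unfold turning, turning_rate.
    rewrite Rmult_0_l, coord_0, Rmult_0_r, exp_0.
    pose proof (radius_sqr q 0 Hq) as HB; pose proof (radius_pos q 0 Hq) as HB0.
    set (B := radius q 0) in *.
    assert (HqB : q * B ^ 2 = q + 1) by (rewrite HB; field; lra).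
    pose proof (dcoord_0 q C) as HD; pose proof (dcoord_gt_0 q C 0) as HD0.
    set (D := dcoord C 0) in *.
    pose proof (sqrt_lt_R0 q Hq) as Hs; pose proof (pow2_sqrt q ltac:(lra)) as Hs2.
    set (s := sqrt q) in *.
    assert (E : 1 / (B + 1) + q = s ^ 2 * B).
    { rewrite Hs2; apply Rmult_eq_reg_r with (B + 1); [ | lra].
      replace ((1 / (B + 1) + q) * (B + 1)) with (1 + q * (B + 1)) by (field; lra).
      nra. }
    rewrite E; replace (1 * D / s * (s ^ 2 * B)) with (D * s * B) by (field; lra).
    assert (H2 : (D * s * B) ^ 2 = (sqrt 2 / 2) ^ 2).
    { replace ((sqrt 2 / 2) ^ 2) with (sqrt 2 ^ 2 / 4) by field; rewrite pow2_sqrt by lra.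
      replace ((D * s * B) ^ 2) with (D ^ 2 * (s ^ 2 * B ^ 2)) by ring.
      rewrite Hs2, HqB; lra. }
    assert (0 < D * s * B) by (repeat apply Rmult_lt_0_compat; lra).
    assert (0 < sqrt 2) by (apply sqrt_lt_R0; lra).
    apply Rsqr_inj; try lra; unfold Rsqr; lra.
Qed.

Lemma RInt_le_const (f : R -> R) (a b M : R) : a <= b -> ex_RInt f a b ->
  (forall x, a < x < b -> f x <= M) -> RInt f a b <= M * (b - a).
Proof.
  intros Hab Hf HM.
  apply Rle_trans with (RInt (fun _ => M) a b).
  - apply RInt_le; auto; apply ex_RInt_const.
  - rewrite RInt_const; unfold scal; simpl; unfold mult; simpl; lra.
Qed.

Lemma sin_ge_sin (d t : R) : 0 <= d <= PI / 2 -> d <= t <= PI - d -> sin d <= sin t.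
Proof.
  intros Hd Ht; destruct (Rle_or_lt t (PI / 2)).
  - apply sin_incr_1; lra.
  - rewrite <- (sin_PI_x t); apply sin_incr_1; lra.
Qed.

(** The phase circle is cut at d, pi - d and pi. The two intervals of length d together, the middle
    one, and the excess over pi on the last half each cost at most eps / 4. *)
Lemma advance_large (q : R) (C : chart q) (eps : R) : 0 < q -> 0 < eps ->
  exists A, 0 < A /\ advance C A < PI + eps.
Proof.
  intros Hq He; assert (Hpi := PI_RGT_0).
  set (M := 1 / q * (1 + q)).
  assert (HM : 0 < M).
  { apply Rmult_lt_0_compat; [apply Rdiv_lt_0_compat | ]; lra. }
  pose proof (sqrt_lt_R0 q Hq) as Hs.
  set (d := Rmin (PI / 2) (eps / (8 * M))).
  assert (Hd : 0 < d) by (apply Rmin_glb_lt; apply Rdiv_lt_0_compat; lra).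
  assert (Hd1 : d <= PI / 2) by apply Rmin_l.
  assert (Hd2 : 2 * (M * d) <= eps / 4).
  { apply Rle_trans with (2 * (M * (eps / (8 * M)))); [ | right; field; lra].
    repeat apply Rmult_le_compat_l; try lra; apply Rmin_r. }
  set (eta := eps / (4 * PI)).
  assert (Heta : 0 < eta) by (apply Rdiv_lt_0_compat; lra).
  assert (HY : exists w1, 0 <= w1 /\ exp (- q * coord C w1) / sqrt q * (1 + q) <= eta).
  (* With [coord C w1 = c / q] the exponential is exp (-c) <= 1 / c, and c is chosen so that 1 / c
     yields exactly eta. *)
  { set (c := (1 + q) / (sqrt q * eta)).
    assert (Hc : 0 < c) by (apply Rdiv_lt_0_compat; [ | apply Rmult_lt_0_compat]; lra).
    destruct (coord_unbounded q C (c / q)) as (w1 & Hw1); exists w1.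
    assert (Hcq : 0 < c / q) by (apply Rdiv_lt_0_compat; lra).
    split.
    - destruct (Rle_or_lt 0 w1) as [ | N]; [assumption | ].
      pose proof (coord_le q C w1 0 (Rlt_le _ _ N)) as Hp; rewrite coord_0 in Hp; lra.
    - rewrite Hw1; replace (- q * (c / q)) with (- c) by (field; lra).
      rewrite exp_Ropp; pose proof (exp_ineq1_le c).
      apply Rle_trans with (/ c / sqrt q * (1 + q)).
      + apply Rmult_le_compat_r; [lra | ]; apply Rmult_le_compat_r.
        * left; apply Rinv_0_lt_compat, Hs.
        * apply Rinv_le_contravar; lra.
      + right; unfold c; field; lra. }
  destruct HY as (w1 & Hw1 & Hsmall).
  assert (Hsd : 0 < sin d) by (apply sin_gt_0; lra).
  (* The first term ensures A sin t >= w1 on the middle interval; the second ensures 1 / (q B) <=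
     eps / (4 pi), since B >= A. *)
  set (A := w1 / sin d + 4 * PI / (q * eps)).
  assert (Hqe : 0 < q * eps) by (apply Rmult_lt_0_compat; lra).
  assert (HA1 : 0 < 4 * PI / (q * eps)) by (apply Rdiv_lt_0_compat; lra).
  assert (HA2 : 0 <= w1 / sin d) by (apply Rmult_le_pos; [lra | left; apply Rinv_0_lt_compat, Hsd]).
  assert (HA : 0 < A) by (unfold A; lra).
  exists A; split; [exact HA | ].
  pose proof (radius_pos q A Hq) as HB.
  assert (HBA : A <= radius q A).
  { apply Rsqr_incr_0_var; [ | lra]; unfold Rsqr.
    pose proof (radius_sqr q A Hq); assert (0 < 1 / q) by (apply Rdiv_lt_0_compat; lra); nra. }
  set (f := turning C A).
  assert (Hf : forall a b, ex_RInt f a b) by (intros; apply ex_RInt_turning, Hq).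
  assert (I1 : RInt f 0 d <= M * (d - 0)).
  { apply RInt_le_const; [lra | apply Hf | intros; apply turning_rate_le; assumption]. }
  assert (I3 : RInt f (PI - d) PI <= M * (PI - (PI - d))).
  { apply RInt_le_const; [lra | apply Hf | intros; apply turning_rate_le; assumption]. }
  assert (I2 : RInt f d (PI - d) <= eta * (PI - d - d)).
  { apply RInt_le_const; [lra | apply Hf | ].
    intros t Ht; apply Rle_trans with (2 := Hsmall).
    assert (Hw : w1 <= A * sin t).
    { pose proof (sin_ge_sin d t ltac:(lra) ltac:(lra)).
      replace w1 with (w1 / sin d * sin d) by (field; lra).
      apply Rmult_le_compat; unfold A; lra. }
    apply Rle_trans with (1 := turning_rate_le_pos q C (radius q A) (A * sin t) Hq HB ltac:(lra)).
    apply Rmult_le_compat_r; [lra | ]; apply Rmult_le_compat_r.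
    - left; apply Rinv_0_lt_compat, Hs.
    - pose proof (coord_le q C _ _ Hw) as [Hp | Hp].
      + left; apply exp_increasing; nra.
      + rewrite Hp; right; reflexivity. }
  assert (I4 : RInt f PI (2 * PI) <= (1 + eps / (4 * PI)) * (2 * PI - PI)).
  { apply RInt_le_const; [lra | apply Hf | ].
    intros t Ht.
    assert (Hw : A * sin t <= 0).
    { pose proof (sin_le_0 t ltac:(lra) ltac:(lra)); nra. }
    apply Rle_trans with (1 := turning_rate_le_neg q C (radius q A) (A * sin t) Hq HB Hw).
    apply Rplus_le_compat_l.
    replace (eps / (4 * PI)) with (/ (q * (4 * PI / (q * eps)))) by (field; lra).
    apply Rinv_le_contravar; [apply Rmult_lt_0_compat; lra | ].
    apply Rmult_le_compat_l; [lra | ]; unfold A in *; lra. }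
  assert (HC : advance C A = RInt f 0 d + RInt f d (PI - d) + RInt f (PI - d) PI + RInt f PI (2 * PI)).
  { unfold advance; fold f.
    rewrite <- (RInt_Chasles f 0 PI (2 * PI)) by apply Hf.
    rewrite <- (RInt_Chasles f 0 (PI - d) PI) by apply Hf.
    rewrite <- (RInt_Chasles f 0 d (PI - d)) by apply Hf.
    reflexivity. }
  assert (E1 : eta * (PI - d - d) <= eps / 4).
  { apply Rle_trans with (eta * PI); [apply Rmult_le_compat_l; lra | right; unfold eta; field; lra]. }
  assert (E2 : (1 + eps / (4 * PI)) * (2 * PI - PI) = PI + eps / 4) by (field; lra).
  lra.
Qed.

Lemma advance_surjective (q : R) (C : chart q) (x : R) : 0 < q -> PI < x < sqrt 2 * PI ->
  exists A, 0 < A /\ advance C A = x.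
Proof.
  intros Hq Hx.
  destruct (advance_large q C (x - PI) Hq ltac:(lra)) as (A1 & HA1 & H1).
  pose proof (advance_0 q C Hq) as H0.
  destruct (IVT_gen (advance C) 0 A1 x (continuity_advance q C Hq)) as (A & HA & E).
  - rewrite H0, Rmin_right, Rmax_left by lra; lra.
  - exists A; split; [ | exact E].
    rewrite Rmin_left in HA by lra.
    (* The endpoint A = 0 is excluded because the advance there is sqrt 2 * pi > x. *)
    destruct HA as [[HA | <-] _]; [exact HA | lra].
Qed.

(** * Spherical curves built from a motion *)

(* In the paper's notation [v = sqrt rho * B * x1], [k = sqrt rho], and
   [kappa = k q z / v = k * sqrt q * v^(-(1+q))] with [p = q / (1+q)]. *)
Record motion (q k B : R) := {
  mv : R -> R;
  ma : R -> R;
  mz : R -> R;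
  mth : R -> R;
  mv_pos : forall s, 0 < mv s;
  mz_pos : forall s, 0 < mz s;
  mz_eq : forall s, sqrt q * mz s = Rpower (mv s) (- q);
  energy : forall s, ma s ^ 2 = B ^ 2 - mv s ^ 2 - mz s ^ 2;
  is_derive_mv : forall s, is_derive mv s (k * ma s);
  is_derive_ma : forall s, is_derive ma s (- k * (mv s - q * mz s ^ 2 / mv s));
  is_derive_mz : forall s, is_derive mz s (- (q * k * mz s * ma s / mv s));
  is_derive_mth : forall s, is_derive mth s (k * mz s * (1 / (B + mv s) + q / mv s))
}.

Arguments mv {q k B}.
Arguments ma {q k B}.
Arguments mz {q k B}.
Arguments mth {q k B}.

Definition motion_curve {q k B : R} (M : motion q k B) : curve := fun s =>
  (mv M s / (k * B),
   (ma M s * cos (mth M s) - mz M s * sin (mth M s)) / (k * B),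
   (ma M s * sin (mth M s) + mz M s * cos (mth M s)) / (k * B)).

Lemma is_derive_ext_eq (f g : R -> R) (x l l' : R) :
  (forall t, f t = g t) -> l = l' -> is_derive f x l -> is_derive g x l'.
Proof. intros Hfg <-; apply is_derive_ext, Hfg. Qed.

Lemma derivatives_2 (f f1 f2 : R -> R) :
  (forall s, is_derive f s (f1 s)) -> (forall s, is_derive f1 s (f2 s)) ->
  twice_differentiable f /\ forall s, Derive f s = f1 s /\ Derive_n f 2 s = f2 s.
Proof.
  intros H1 H2.
  assert (E1 : forall s, Derive f s = f1 s) by (intro s; apply is_derive_unique, H1).
  assert (E2 : forall s, is_derive (Derive f) s (f2 s)).
  { intro s; apply is_derive_ext with f1; [intro t; symmetry; apply E1 | apply H2]. }
  split; [ | split; [apply E1 | apply is_derive_unique, E2]].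
  intro s; split; eexists; [apply H1 | apply E2].
Qed.

(** A rotation about the first axis has determinant 1; this removes the angle [mth] from the
    curvature computation. *)
Lemma det3_rot (v a z v1 a1 z1 v2 a2 z2 c s : R) : s ^ 2 = 1 - c ^ 2 ->
  det3 v (a * c - z * s) (a * s + z * c) v1 (a1 * c - z1 * s) (a1 * s + z1 * c)
    v2 (a2 * c - z2 * s) (a2 * s + z2 * c) = det3 v a z v1 a1 z1 v2 a2 z2.
Proof. intros H; unfold det3; ring [H]. Qed.

Lemma det3_scal (u v w a1 a2 a3 b1 b2 b3 c1 c2 c3 : R) :
  det3 (u * a1) (u * a2) (u * a3) (v * b1) (v * b2) (v * b3) (w * c1) (w * c2) (w * c3)
  = u * v * w * det3 a1 a2 a3 b1 b2 b3 c1 c2 c3.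
Proof. unfold det3; ring. Qed.

(* [auto_derive] leaves eta-expanded functions under [Derive]. *)
Ltac use_derive H :=
  match type of H with
  | is_derive ?f ?s ?l =>
      replace (Derive (fun t : R => f t) s) with l by (symmetry; exact (is_derive_unique _ _ _ H))
  end.

Section Geometry.
Context {q k B : R} (hq : 0 < q) (hk : 0 < k) (hB : 0 < B) (M : motion q k B).

(* [(ma, P2, P3)] and [(Q1, Q2, Q3)] are the first two derivatives of the curve, up to
   scaling, in the frame rotating by [mth] around the first axis. *)
Let P2 s := - (mv M s + mz M s ^ 2 / (B + mv M s)).
Let P3 s := mz M s * ma M s / (B + mv M s).
Let Q1 s := q * mz M s ^ 2 / mv M s - mv M s.
Let Q2 s := q * mz M s ^ 2 * ma M s / (mv M s * (B + mv M s)) - ma M s.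
Let Q3 s := q * mz M s / mv M s * (mz M s ^ 2 / (B + mv M s) - B) - mz M s.

Lemma derive_x1 : twice_differentiable (x1 (motion_curve M)) /\
  forall s, Derive (x1 (motion_curve M)) s = / B * ma M s /\
    Derive_n (x1 (motion_curve M)) 2 s = k / B * Q1 s.
Proof.
  apply derivatives_2; intro s; unfold x1, motion_curve; simpl;
  pose proof (mv_pos _ _ _ M s).
  - auto_derive; [eexists; apply (is_derive_mv _ _ _ M) | ].
    use_derive (is_derive_mv _ _ _ M s); field; lra.
  - auto_derive; [eexists; apply (is_derive_ma _ _ _ M) | ].
    use_derive (is_derive_ma _ _ _ M s); unfold Q1; field; lra.
Qed.

(** In complex form, (a + ib) e^(i th) has derivative (a' + ib' + i th' (a + ib)) e^(i th). It is
    applied to ([ma], [mz]) and then to ([P2], [P3]). *)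
Lemma derive_rot (a a' b b' : R -> R) :
  (forall s, is_derive a s (a' s)) -> (forall s, is_derive b s (b' s)) -> forall c s,
  let th' := k * mz M s * (1 / (B + mv M s) + q / mv M s) in
  is_derive (fun s => c * (a s * cos (mth M s) - b s * sin (mth M s))) s
    (c * ((a' s - th' * b s) * cos (mth M s) - (b' s + th' * a s) * sin (mth M s))) /\
  is_derive (fun s => c * (a s * sin (mth M s) + b s * cos (mth M s))) s
    (c * ((a' s - th' * b s) * sin (mth M s) + (b' s + th' * a s) * cos (mth M s))).
Proof.
  intros Ha Hb c s th'.
  split; auto_derive; try (repeat split; first [exact (ex_intro _ _ (Ha s)) |
    exact (ex_intro _ _ (Hb s)) | exact (ex_intro _ _ (is_derive_mth _ _ _ M s))]);
  use_derive (Ha s); use_derive (Hb s); use_derive (is_derive_mth _ _ _ M s); fold th'; ring.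
Qed.

(** The rotation term is written so that it cancels against the one in [derive_rot], leaving k times
    [Q2]; likewise for [P3] and [Q3]. *)
Lemma derive_P2 s : is_derive P2 s
  (k * Q2 s + k * mz M s * (1 / (B + mv M s) + q / mv M s) * P3 s).
Proof.
  pose proof (mv_pos _ _ _ M s); unfold P2.
  auto_derive.
  - repeat split; first [exact (ex_intro _ _ (is_derive_mv _ _ _ M s)) |
      exact (ex_intro _ _ (is_derive_mz _ _ _ M s)) | lra].
  - use_derive (is_derive_mv _ _ _ M s); use_derive (is_derive_mz _ _ _ M s); unfold Q2, P3; field; lra.
Qed.

Lemma derive_P3 s : is_derive P3 s
  (k * Q3 s - k * mz M s * (1 / (B + mv M s) + q / mv M s) * P2 s).
Proof.
  pose proof (mv_pos _ _ _ M s); pose proof (energy _ _ _ M s) as HE; unfold P3.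
  auto_derive.
  - repeat split; first [exact (ex_intro _ _ (is_derive_mv _ _ _ M s)) |
      exact (ex_intro _ _ (is_derive_mz _ _ _ M s)) |
      exact (ex_intro _ _ (is_derive_ma _ _ _ M s)) | lra].
  - use_derive (is_derive_mv _ _ _ M s); use_derive (is_derive_mz _ _ _ M s);
    use_derive (is_derive_ma _ _ _ M s); unfold Q3, P2; field [HE]; lra.
Qed.

Lemma derive_x2_x3 :
  (twice_differentiable (x2 (motion_curve M)) /\
   forall s,
   Derive (x2 (motion_curve M)) s = / B * (P2 s * cos (mth M s) - P3 s * sin (mth M s)) /\
   Derive_n (x2 (motion_curve M)) 2 s = k / B * (Q2 s * cos (mth M s) - Q3 s * sin (mth M s))) /\
  (twice_differentiable (x3 (motion_curve M)) /\
   forall s,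
   Derive (x3 (motion_curve M)) s = / B * (P2 s * sin (mth M s) + P3 s * cos (mth M s)) /\
   Derive_n (x3 (motion_curve M)) 2 s = k / B * (Q2 s * sin (mth M s) + Q3 s * cos (mth M s))).
Proof.
  pose proof (derive_rot _ _ _ _ (is_derive_ma _ _ _ M) (is_derive_mz _ _ _ M) (/ (k * B))) as H1.
  pose proof (derive_rot _ _ _ _ derive_P2 derive_P3 (/ B)) as H2.
  split; apply derivatives_2; intro s; pose proof (mv_pos _ _ _ M s).
  (* The q / v part of the rotation speed cancels the q terms of the derivatives of [ma] and [mz],
     leaving k [P2] and k [P3]. *)
  - eapply is_derive_ext_eq; [ | | exact (proj1 (H1 s))].
    + intro t; unfold x2, motion_curve; simpl; unfold Rdiv; ring.
    + unfold P2, P3; field; lra.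
  - eapply is_derive_ext_eq; [reflexivity | | exact (proj1 (H2 s))]; cbv beta zeta; field; lra.
  - eapply is_derive_ext_eq; [ | | exact (proj2 (H1 s))].
    + intro t; unfold x3, motion_curve; simpl; unfold Rdiv; ring.
    + unfold P2, P3; field; lra.
  - eapply is_derive_ext_eq; [reflexivity | | exact (proj2 (H2 s))]; cbv beta zeta; field; lra.
Qed.

Lemma motion_curve_on_sphere : on_sphere (k ^ 2) (motion_curve M).
Proof.
  intro s; unfold x1, x2, x3, motion_curve; simpl.
  pose proof (energy _ _ _ M s) as HE.
  pose proof (sin2_cos2 (mth M s)) as HC; unfold Rsqr in HC.
  assert (HS : sin (mth M s) ^ 2 = 1 - cos (mth M s) ^ 2) by (simpl; lra).
  field [HE HS]; lra.
Qed.

(** The energy identity gives P2^2 + P3^2 = v^2 + z^2, so the squared speed is (a^2 + v^2 + z^2) /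
    B^2 = 1. *)
Lemma motion_curve_arc_length : arc_length_parametrized (motion_curve M).
Proof.
  destruct derive_x1 as (H1 & E1), derive_x2_x3 as ((H2 & E2) & (H3 & E3)).
  repeat split; try apply H1; try apply H2; try apply H3; intro s.
  rewrite (proj1 (E1 s)), (proj1 (E2 s)), (proj1 (E3 s)); unfold P2, P3.
  pose proof (energy _ _ _ M s) as HE; pose proof (mv_pos _ _ _ M s).
  pose proof (sin2_cos2 (mth M s)) as HC; unfold Rsqr in HC.
  assert (HS : sin (mth M s) ^ 2 = 1 - cos (mth M s) ^ 2) by (simpl; lra).
  field [HE HS]; lra.
Qed.

Lemma motion_curve_curvature s :
  geodesic_curvature (k ^ 2) (motion_curve M) s = k * q * mz M s / mv M s.
Proof.
  destruct derive_x1 as (_ & E1), derive_x2_x3 as ((_ & E2) & (_ & E3)).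
  unfold geodesic_curvature.
  rewrite (proj1 (E1 s)), (proj1 (E2 s)), (proj1 (E3 s)).
  rewrite (proj2 (E1 s)), (proj2 (E2 s)), (proj2 (E3 s)).
  unfold x1, x2, x3, motion_curve; simpl fst; simpl snd.
  (* The rows of the determinant carry the scalars 1 / (k B), 1 / B and k / B, pulled out by
     [det3_scal]. *)
  unfold Rdiv at 1 2 3; rewrite !(Rmult_comm _ (/ (k * B))).
  rewrite det3_scal, det3_rot.
  - pose proof (energy _ _ _ M s) as HE; pose proof (mv_pos _ _ _ M s).
    rewrite sqrt_pow2 by lra.
    unfold det3, P2, P3, Q1, Q2, Q3; field [HE]; lra.
  - pose proof (sin2_cos2 (mth M s)) as HC; unfold Rsqr in HC; simpl; lra.
Qed.

End Geometry.

(** * The Euler-Lagrange equation and its first integral *)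

Section Elastic.
Context {q k B : R} (hq : 0 < q) (hk : 0 < k) (hB : 0 < B) (M : motion q k B).

Let p := q / (1 + q).
Let c := Rpower (k * sqrt q) (p - 1).

Lemma exponent_pos : 0 < p.
Proof. apply Rdiv_lt_0_compat; lra. Qed.

Lemma curvature_gt_0 s : 0 < geodesic_curvature (k ^ 2) (motion_curve M) s.
Proof.
  rewrite (motion_curve_curvature hk hB); pose proof (mv_pos _ _ _ M s); pose proof (mz_pos _ _ _ M s).
  apply Rdiv_lt_0_compat; repeat apply Rmult_lt_0_compat; lra.
Qed.

(** The curvature is k sqrt q v^(-(1+q)) and (1 + q) (1 - p) = 1, so this power of it is linear in
    v. *)
Lemma curvature_Rpower s :
  Rpower (geodesic_curvature (k ^ 2) (motion_curve M) s) (p - 1) = c * mv M s.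
Proof.
  rewrite (motion_curve_curvature hk hB); pose proof (mv_pos _ _ _ M s).
  pose proof (sqrt_lt_R0 q hq).
  replace (k * q * mz M s / mv M s) with (k * sqrt q * Rpower (mv M s) (- (1 + q))).
  - rewrite <- Rpower_mult_distr by (try apply exp_pos; apply Rmult_lt_0_compat; lra).
    rewrite Rpower_mult; unfold c, p; f_equal.
    replace (- (1 + q) * (q / (1 + q) - 1)) with 1 by (field; lra).
    apply Rpower_1; assumption.
  - replace (- (1 + q)) with (- q + - (1)) by ring.
    rewrite Rpower_plus, <- mz_eq, Rpower_Ropp, Rpower_1 by assumption.
    replace (k * sqrt q * (sqrt q * mz M s * / mv M s))
      with (k * (sqrt q * sqrt q) * mz M s / mv M s) by (field; lra).
    rewrite sqrt_sqrt; lra.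
Qed.

(** As p kappa^(p-1) = p c v, its second derivative is given by the law of motion, and what remains
    cancels by p (1 + q) = q. *)
Lemma motion_curve_euler_lagrange :
  euler_lagrange (k ^ 2) p (geodesic_curvature (k ^ 2) (motion_curve M)).
Proof.
  set (kappa := geodesic_curvature (k ^ 2) (motion_curve M)).
  destruct (derivatives_2 (fun s => p * Rpower (kappa s) (p - 1))
    (fun s => p * c * k * ma M s)
    (fun s => p * c * k * (- k * (mv M s - q * mz M s ^ 2 / mv M s)))) as (H & E).
  - intro s; apply is_derive_ext_eq with (f := fun s => p * c * mv M s)
      (l := p * c * (k * ma M s)).
    + intro t; unfold kappa; rewrite curvature_Rpower; ring.
    + ring.
    + apply (is_derive_scal (mv M)), is_derive_mv.
  - intro s; apply (is_derive_scal (ma M)), is_derive_ma.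
  - split; [exact H | ].
    intro s; rewrite (proj2 (E s)).
    replace (p + 1) with (INR 2 + (p - 1)) by (simpl; ring).
    rewrite Rpower_plus, Rpower_pow by apply curvature_gt_0.
    unfold kappa; rewrite curvature_Rpower, (motion_curve_curvature hk hB).
    pose proof (mv_pos _ _ _ M s); unfold p; field; lra.
Qed.

Lemma motion_curve_p_elastic : p_elastic (k ^ 2) p (motion_curve M).
Proof.
  split; [exact (motion_curve_on_sphere hk hB M) | ].
  split; [exact (motion_curve_arc_length hk hB M) | ].
  split; [exact curvature_gt_0 | exact motion_curve_euler_lagrange].
Qed.

Lemma motion_curve_in_pole_coordinates : in_pole_coordinates (k ^ 2) p (motion_curve M).
Proof.
  assert (Hc : 0 < c) by apply exp_pos.
  pose proof exponent_pos as Hp.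
  assert (Hd : 0 < k * p * c * B) by (repeat (assumption || apply Rmult_lt_0_compat)).
  (* Comparing x1 = v / (k B) with p c v / sqrt d forces sqrt d = k p c B. *)
  exists ((k * p * c * B) ^ 2); split; [apply pow_lt; exact Hd | split]; intro s;
    pose proof (mv_pos _ _ _ M s) as Hv; pose proof (mz_pos _ _ _ M s).
  - assert (D : is_derive (geodesic_curvature (k ^ 2) (motion_curve M)) s
      (- (k * (1 + q) * ma M s / mv M s * (k * q * mz M s / mv M s)))).
    { apply is_derive_ext_eq with (f := fun s => k * q * mz M s / mv M s)
        (l := k * q * ((- (q * k * mz M s * ma M s / mv M s)) * mv M s - mz M s * (k * ma M s))
              / mv M s ^ 2).
      - intro t; rewrite (motion_curve_curvature hk hB); reflexivity.
      - field; lra.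
      - auto_derive.
        + repeat split; first [exact (ex_intro _ _ (is_derive_mv _ _ _ M s)) |
            exact (ex_intro _ _ (is_derive_mz _ _ _ M s)) | lra].
        + use_derive (is_derive_mv _ _ _ M s); use_derive (is_derive_mz _ _ _ M s); field; lra. }
    split; [exists (- (k * (1 + q) * ma M s / mv M s * (k * q * mz M s / mv M s))); exact D | ].
    rewrite (is_derive_unique _ _ _ D).
    replace (2 * (1 - p)) with (- ((p - 1) + (p - 1))) by ring.
    rewrite Rpower_Ropp, Rpower_plus, curvature_Rpower, (motion_curve_curvature hk hB).
    (* Both sides divided by kappa^2 equal (k (1 + q) a / v)^2 by the energy identity. *)
    pose proof (energy _ _ _ M s) as HE.
    replace ((k * p * c * B) ^ 2 * / (c * mv M s * (c * mv M s)))
      with (k ^ 2 * p ^ 2 * B ^ 2 / mv M s ^ 2) by (field; lra).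
    unfold p; field [HE]; repeat split; lra.
  - rewrite curvature_Rpower, sqrt_pow2 by lra.
    unfold x1, motion_curve; simpl; field; lra.
Qed.

End Elastic.

(** * The winding number *)

Lemma motion_curve_winding (q k B L : R) (M : motion q k B) (w : Z) :
  0 < k -> 0 < B -> ma M L = ma M 0 -> mz M L = mz M 0 ->
  mth M L = mth M 0 + 2 * PI * IZR w ->
  winding_number (x2 (motion_curve M)) (x3 (motion_curve M)) L w.
Proof.
  intros hk hB Ea Ez Eth.
  (* Since z > 0, pi/2 - atan (a / z) is a continuous argument of a + iz. It agrees at both ends, so
     only [mth] contributes. *)
  exists (fun s => mth M s + (PI / 2 - atan (ma M s / mz M s))); split; [ | split].
  - intro s; pose proof (mz_pos _ _ _ M s).
    assert (continuous (ma M) s) by exact (is_derive_continuous _ _ _ (is_derive_ma _ _ _ M s)).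
    assert (continuous (mz M) s) by exact (is_derive_continuous _ _ _ (is_derive_mz _ _ _ M s)).
    apply continuous_Rplus; [exact (is_derive_continuous _ _ _ (is_derive_mth _ _ _ M s)) | ].
    apply continuous_Rminus; [apply continuous_const | ].
    apply (continuous_comp (fun s => ma M s / mz M s) atan).
    + apply continuous_Rdiv; auto; lra.
    + apply continuous_atan.
  - intros s _; pose proof (mz_pos _ _ _ M s) as Hz.
    unfold x2, x3, motion_curve; simpl fst; simpl snd.
    set (t := ma M s / mz M s); set (w' := sqrt (1 + t ^ 2)).
    assert (Hw2 : w' ^ 2 = 1 + t ^ 2) by (apply pow2_sqrt; nra).
    assert (Hw : 0 < w') by (apply sqrt_lt_R0; nra).
    replace (ma M s) with (t * mz M s) by (unfold t; field; lra).
    pose proof (sin2_cos2 (mth M s)) as HC; unfold Rsqr in HC.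
    assert (HS : sin (mth M s) ^ 2 = 1 - cos (mth M s) ^ 2) by (simpl; lra).
    assert (HR : ((t * mz M s * cos (mth M s) - mz M s * sin (mth M s)) / (k * B)) ^ 2 +
       ((t * mz M s * sin (mth M s) + mz M s * cos (mth M s)) / (k * B)) ^ 2
       = (mz M s * w' / (k * B)) ^ 2) by (field [HS Hw2]; lra).
    assert (Hpos : 0 < mz M s * w' / (k * B)).
    { apply Rdiv_lt_0_compat; apply Rmult_lt_0_compat; assumption. }
    rewrite HR, sqrt_pow2 by lra.
    rewrite cos_plus, sin_plus, cos_shift, sin_shift, sin_atan, cos_atan.
    unfold Rsqr; replace (1 + t * t) with (1 + t ^ 2) by ring; fold w'.
    split; [ | split; field; lra].
    intro E0; injection E0 as E1 E2; rewrite E1, E2 in HR.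
    pose proof (pow_lt _ 2 Hpos); lra.
  - rewrite Ea, Ez, Eth; ring.
Qed.

(** * Periodic primitives and the motion in time *)

Lemma cos_eq_1 (x : R) : cos x = 1 -> exists j : Z, x = 2 * PI * IZR j.
Proof.
  intro H.
  assert (Hs : sin (x / 2) = 0).
  { replace x with (2 * (x / 2)) in H by field; rewrite cos_2a_sin in H; nra. }
  destruct (sin_eq_0_0 _ Hs) as (j & Hj); exists j; lra.
Qed.

(** Serves for elapsed time and for the rotation angle as functions of the phase; the integral over
    [P, x + P] is translated back to [0, x]. *)
Lemma periodic_primitive (h : R -> R) (P : R) :
  (forall x, continuous h x) -> (forall x, h (x + P) = h x) ->
  (forall x, is_derive (RInt h 0) x (h x)) /\
  forall x, RInt h 0 (x + P) = RInt h 0 x + RInt h 0 P.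
Proof.
  intros Hc Hp.
  assert (Hi : forall a b, ex_RInt h a b).
  { intros a b; apply (ex_RInt_continuous (V := R_CompleteNormedModule)); auto. }
  split; intro x.
  - apply (is_derive_RInt h (RInt h 0) 0); [ | apply Hc].
    apply filter_forall; intro b; apply (RInt_correct (V := R_CompleteNormedModule)), Hi.
  - rewrite <- (RInt_Chasles h 0 P (x + P)) by apply Hi.
    assert (E : RInt h P (x + P) = RInt h 0 x).
    { pose proof (RInt_comp_lin h 1 P 0 x (Hi _ _)) as E.
      rewrite !Rmult_1_l, Rplus_0_l in E.
      rewrite <- E; apply RInt_ext; intros t _.
      rewrite !Rmult_1_l, Hp; reflexivity. }
    rewrite E; unfold plus; simpl; ring.
Qed.

Lemma quasi_periodic_iter (F : R -> R) (P c : R) :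
  (forall x, F (x + P) = F x + c) -> forall n x, F (x + INR n * P) = F x + INR n * c.
Proof.
  intros H n; induction n as [ | n IH]; intro x.
  - simpl; rewrite !Rmult_0_l, !Rplus_0_r; reflexivity.
  - rewrite S_INR; replace (x + (INR n + 1) * P) with (x + INR n * P + P) by ring.
    rewrite H, IH; ring.
Qed.

(* [phi] is the inverse of the time elapsed as a function of the phase. *)
Lemma phase_exists (q k A : R) (C : chart q) : 0 < q -> 0 < k ->
  exists (phi : R -> R) (T : R), 0 < T /\ phi 0 = 0 /\
    (forall s, is_derive phi s
       (k / (exp (coord C (A * sin (phi s))) * dcoord C (A * sin (phi s))))) /\
    forall s, phi (s + T) = phi s + 2 * PI.
Proof.
  intros Hq Hk; assert (Hpi := PI_RGT_0).
  (* Time per unit of phase: with w = A sin phi and v = exp (coord w), the law v' = k A cos phi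
     forces phi' = k / (v dcoord w). *)
  set (h := fun t => exp (coord C (A * sin t)) * dcoord C (A * sin t) / k).
  assert (Hh : forall t, 0 < h t).
  { intro t; apply Rdiv_lt_0_compat; [ | exact Hk].
    apply Rmult_lt_0_compat; [apply exp_pos | apply dcoord_gt_0]. }
  assert (Hc : forall t, continuous h t).
  { intro t; unfold h.
    assert (Hs : continuous (fun t => A * sin t) t).
    { apply continuous_Rmult; [apply continuous_const | apply continuous_sin]. }
    apply continuous_Rmult; [apply continuous_Rmult | apply continuous_const].
    - apply (continuous_comp (fun t => coord C (A * sin t)) exp).
      + apply (continuous_comp (fun t => A * sin t)); [exact Hs | apply continuous_coord].
      + exact (is_derive_continuous _ _ _ (is_derive_exp _)).
    - apply (continuous_comp (fun t => A * sin t)); [exact Hs | apply continuous_dcoord]. }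
  assert (Hp : forall t, h (t + 2 * PI) = h t).
  { intro t; unfold h; pose proof (sin_period t 1) as E; simpl in E.
    replace (t + 2 * 1 * PI) with (t + 2 * PI) in E by ring; rewrite E; reflexivity. }
  destruct (periodic_primitive h (2 * PI) Hc Hp) as (HF & HFP).
  set (F := RInt h 0) in *; set (T := F (2 * PI)) in *.
  pose proof (quasi_periodic_iter F (2 * PI) T HFP) as Hit.
  assert (F0 : F 0 = 0) by apply (RInt_point (V := R_CompleteNormedModule)).
  assert (HT : 0 < T).
  { pose proof (positive_derivative_lt F h HF Hh 0 (2 * PI) ltac:(lra)); unfold T; lra. }
  assert (Hsurj : forall y, exists a b, F a <= y <= F b).
  { intro y.
    destruct (INR_unbounded (Rabs y / T)) as (n & Hn).
    assert (HnT : Rabs y <= INR n * T).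
    { replace (Rabs y) with (Rabs y / T * T) by (field; lra); apply Rmult_le_compat_r; lra. }
    exists (- (INR n * (2 * PI))), (0 + INR n * (2 * PI)).
    pose proof (Hit n (- (INR n * (2 * PI)))) as E1; rewrite Rplus_opp_l, F0 in E1.
    rewrite Hit, F0; apply Rabs_le_between in HnT; lra. }
  destruct (inverse_function F h HF Hh Hsurj) as (phi & H1 & H2 & H3).
  exists phi, T; split; [exact HT | split; [ | split]].
  - rewrite <- F0 at 1; apply H2.
  - intro s; eapply is_derive_ext_eq; [reflexivity | | apply H3].
    unfold h; field.
    pose proof (exp_pos (coord C (A * sin (phi s)))); pose proof (dcoord_gt_0 q C (A * sin (phi s))).
    repeat split; lra.
  - intro s; rewrite <- (H2 (phi s + 2 * PI)), HFP, H1; reflexivity.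
Qed.

Lemma motion_exists (q k A : R) (C : chart q) : 0 < q -> 0 < k ->
  exists (M : motion q k (radius q A)) (phi : R -> R) (T : R),
    0 < T /\ phi 0 = 0 /\ (forall s, continuous phi s) /\
    (forall s t, s < t -> phi s < phi t) /\
    (forall s, phi (s + T) = phi s + 2 * PI) /\
    (forall s, mv M s = exp (coord C (A * sin (phi s)))) /\
    (forall s, ma M s = A * cos (phi s)) /\
    (forall s, mz M s = exp (- q * coord C (A * sin (phi s))) / sqrt q) /\
    mth M 0 = 0 /\
    (forall s, mth M (s + T) = mth M s + advance C A).
Proof.
  intros Hq Hk.
  destruct (phase_exists q k A C Hq Hk) as (phi & T & HT & Hphi0 & Hphi & HphiT).
  pose proof (sqrt_lt_R0 q Hq) as Hs; pose proof (pow2_sqrt q ltac:(lra)) as Hss.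
  pose proof (radius_pos q A Hq) as HB; pose proof (radius_sqr q A Hq) as HB2.
  destruct (periodic_primitive (turning C A) (2 * PI)) as (HTh & HThP).
  { intro t; apply continuous_turning, Hq. }
  { intro t; unfold turning; pose proof (sin_period t 1) as E; simpl in E.
    replace (t + 2 * 1 * PI) with (t + 2 * PI) in E by ring; rewrite E; reflexivity. }
  set (Y := fun s => coord C (A * sin (phi s))).
  set (D := fun s => dcoord C (A * sin (phi s))).
  assert (HD : forall s, 0 < D s) by (intro s; apply dcoord_gt_0).
  assert (HY : forall s, is_derive Y s (k * A * cos (phi s) / exp (Y s))).
  { intro s; unfold Y.
    apply is_derive_ext_eq with (f := fun s => coord C (A * sin (phi s)))
      (l := A * cos (phi s) * (k / (exp (Y s) * D s)) * D s); [reflexivity | | ].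
    - pose proof (exp_pos (Y s)); pose proof (HD s); unfold Y; field.
      split; [apply Rgt_not_eq; apply exp_pos | apply Rgt_not_eq; apply HD].
    - apply (is_derive_comp (coord C) (fun s => A * sin (phi s))); [apply is_derive_coord | ].
      auto_derive; [eexists; apply Hphi | ].
      use_derive (Hphi s); fold (Y s) (D s); ring. }
  assert (Hexp : forall s, exp (2 * Y s) = exp (Y s) ^ 2 /\
    exp (- (2 * q) * Y s) = exp (- q * Y s) ^ 2).
  { intro s; split; simpl; rewrite Rmult_1_r, <- exp_plus; f_equal; ring. }
  unshelve eexists.
  { refine {| mv := fun s => exp (Y s); ma := fun s => A * cos (phi s);
      mz := fun s => exp (- q * Y s) / sqrt q; mth := fun s => RInt (turning C A) 0 (phi s) |};
    intro s; pose proof (exp_pos (Y s)) as Hv; pose proof (exp_pos (- q * Y s)) as Hz.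
    - exact Hv.
    - apply Rdiv_lt_0_compat; assumption.
    - unfold Rpower; rewrite ln_exp; field; lra.
    (* The energy identity is [potential_coord] at w = A sin phi, combined with a = A cos phi. *)
    - pose proof (potential_coord q C (A * sin (phi s))) as E; fold (Y s) in E.
      unfold potential in E; destruct (Hexp s) as (E1 & E2); rewrite E1, E2 in E.
      replace ((exp (- q * Y s) / sqrt q) ^ 2) with (exp (- q * Y s) ^ 2 / q)
        by (generalize (exp (- q * Y s)); intro x; field [Hss]; lra).
      pose proof (sin2_cos2 (phi s)) as HC; unfold Rsqr in HC.
      rewrite HB2.
      replace (A ^ 2) with (A ^ 2 * (sin (phi s) * sin (phi s) + cos (phi s) * cos (phi s)))
        by (rewrite HC; ring).
      lra.
    - auto_derive; [eexists; apply HY | ]; use_derive (HY s); field; lra.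
    (* [dcoord_eq] reads D (v^2 - q z^2) = A sin phi, which converts -A sin phi times phi' into the
       force. *)
    - pose proof (dcoord_eq q C (A * sin (phi s))) as E; fold (Y s) (D s) in E.
      destruct (Hexp s) as (E1 & E2); rewrite E1, E2 in E.
      auto_derive; [eexists; apply Hphi | ]; use_derive (Hphi s); fold (Y s) (D s).
      pose proof (HD s).
      replace (q * (exp (- q * Y s) / sqrt q) ^ 2) with (exp (- q * Y s) ^ 2)
        by (generalize (exp (- q * Y s)); intro x; rewrite <- Hss at 1; field; lra).
      apply Rminus_diag_uniq.
      replace (A * (1 * (k / (exp (Y s) * D s)) * - sin (phi s)))
        with (- (A * sin (phi s)) * k / (exp (Y s) * D s)) by (field; lra).
      rewrite <- E; field; lra.
    - auto_derive; [eexists; apply HY | ]; use_derive (HY s); field; lra.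
    - eapply is_derive_ext_eq; [reflexivity | |
        apply (is_derive_comp (RInt (turning C A) 0) phi); [apply HTh | apply Hphi]].
      unfold turning, turning_rate, scal; simpl; unfold mult; simpl; fold (Y s) (D s).
      pose proof (HD s); field; lra. }
  exists phi, T; split; [exact HT | ]; split; [exact Hphi0 | ];
    split; [intro s; exact (is_derive_continuous _ _ _ (Hphi s)) | ];
    split; [ | split; [exact HphiT | ]];
    [ | do 3 (split; [reflexivity | ]); split]; simpl.
  - apply (positive_derivative_lt phi _ Hphi).
    intro s; apply Rdiv_lt_0_compat; [exact Hk | ].
    apply Rmult_lt_0_compat; [apply exp_pos | apply dcoord_gt_0].
  - rewrite Hphi0; apply (RInt_point (V := R_CompleteNormedModule)).
  - intro s; rewrite HphiT; apply HThP.
Qed.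

(** * Closed curves *)

Lemma closed_motion_exists (q k x : R) : 0 < q -> 0 < k -> PI < x < sqrt 2 * PI ->
  exists (B : R) (M : motion q k B) (T : R),
    0 < B /\ 0 < T /\ mth M 0 = 0 /\ (exists s, mv M s <> mv M 0) /\
    (forall s, mv M (s + T) = mv M s /\ ma M (s + T) = ma M s /\ mz M (s + T) = mz M s /\
       mth M (s + T) = mth M s + x) /\
    forall T', 0 < T' -> (forall s, mv M (s + T') = mv M s) ->
      exists m : nat, (1 <= m)%nat /\ T' = INR m * T.
Proof.
  intros Hq Hk Hx; assert (Hpi := PI_RGT_0).
  destruct (chart_exists q Hq) as [C].
  destruct (advance_surjective q C x Hq Hx) as (A & HA & Hadv).
  destruct (motion_exists q k A C Hq Hk)
    as (M & phi & T & HT & phi0 & Hphi_cont & Hinc & HphiT & Hv & Ha & Hz & Hth0 & HthT).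
  pose proof (quasi_periodic_iter phi T (2 * PI) HphiT) as Hit.
  assert (Hcoord : forall w w', coord C w = coord C w' -> w = w').
  { intros w w' E.
    pose proof (positive_derivative_lt _ _ (is_derive_coord q C) (dcoord_gt_0 q C)) as L.
    destruct (Rtotal_order w w') as [N | [N | N]]; [ | exact N | ]; apply L in N; lra. }
  assert (Hsc : forall s, sin (phi (s + T)) = sin (phi s) /\ cos (phi (s + T)) = cos (phi s)).
  { intro s; rewrite HphiT; pose proof (sin_period (phi s) 1); pose proof (cos_period (phi s) 1).
    simpl in *; rewrite !Rmult_1_r in *; split; assumption. }
  exists (radius q A), M, T; split; [apply radius_pos, Hq | ].
  split; [exact HT | ]; split; [exact Hth0 | ].
  assert (Hv_inj : forall s t, mv M s = mv M t -> sin (phi s) = sin (phi t)).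
  { intros s t E; rewrite !Hv in E; apply exp_inv, Hcoord in E.
    apply Rmult_eq_reg_l with A; lra. }
  split; [ | split].
  (* At phase pi/2 the sine differs from its value at phase 0, hence so does v. *)
  - assert (Hs : exists s, phi s = PI / 2).
    { destruct (IVT_gen phi 0 T (PI / 2)) as (s & _ & Hs); [ | | eauto].
      - intro s; apply continuity_pt_filterlim, Hphi_cont.
      - pose proof (HphiT 0) as E; rewrite Rplus_0_l, phi0 in E.
        rewrite phi0, E, Rmin_left, Rmax_right by lra; lra. }
    destruct Hs as (s & Hs); exists s; intro E; apply Hv_inj in E.
    rewrite Hs, phi0, sin_PI2, sin_0 in E; lra.
  - intro s; rewrite !Hv, !Ha, !Hz, HthT, (proj1 (Hsc s)), (proj2 (Hsc s)), Hadv; auto.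
  - intros T' HT' HvT.
    (* A period of v is also one of its derivative k a. So cos phi = 1 at T', the phase there is a
       positive multiple of 2 pi, and strict monotonicity of phi gives T' as that multiple of T. *)
    assert (HaT : ma M T' = ma M 0).
    { pose proof (is_derive_mv _ _ _ M T') as D1.
      assert (D2 : is_derive (mv M) T' (k * ma M 0)).
      { apply is_derive_ext with (fun t => mv M (t - T')).
        - intro t; rewrite <- (HvT (t - T')); f_equal; ring.
        - eapply is_derive_ext_eq; [reflexivity | |
            apply (is_derive_comp (mv M) (fun t => t - T') T' (k * ma M 0) 1)].
          + unfold scal; simpl; unfold mult; simpl; ring.
          + rewrite Rminus_diag; apply is_derive_mv.
          + auto_derive; [exact I | ring]. }
      pose proof (is_derive_unique _ _ _ D1); pose proof (is_derive_unique _ _ _ D2).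
      apply Rmult_eq_reg_l with k; lra. }
    rewrite !Ha, phi0, cos_0 in HaT.
    assert (Hc1 : cos (phi T') = 1) by (apply Rmult_eq_reg_l with A; lra).
    destruct (cos_eq_1 _ Hc1) as (j & Hj).
    assert (Hj0 : 0 < IZR j).
    { pose proof (Hinc 0 T' HT'); rewrite phi0 in *.
      apply Rmult_lt_reg_l with (2 * PI); lra. }
    apply lt_IZR in Hj0.
    exists (Z.to_nat j); split; [lia | ].
    pose proof (Hit (Z.to_nat j) 0) as E.
    rewrite Rplus_0_l, phi0, Rplus_0_l in E.
    rewrite INR_IZR_INZ, Z2Nat.id in * by lia.
    assert (E' : phi T' = phi (IZR j * T)) by lra.
    destruct (Rtotal_order T' (IZR j * T)) as [N | [N | N]]; [ | exact N | ];
      apply Hinc in N; lra.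
Qed.

Theorem theorem4p5 (rho : R) (hrho : 0 < rho) (l r : nat)
    (hlr : Nat.gcd l r = 1%nat)
    (h1 : INR r < 2 * INR l) (h2 : 2 * INR l < sqrt 2 * INR r)
    (n : nat) (hn : (3 <= n)%nat) :
  exists (g : curve) (L : R),
    p_elastic rho ((INR n - 2) / (INR n + 1)) g /\
    nonconstant (geodesic_curvature rho g) /\
    in_pole_coordinates rho ((INR n - 2) / (INR n + 1)) g /\
    least_period g L /\
    winds_around_pole g L l /\
    has_lobes rho g L r.
Proof.
  assert (Hpi := PI_RGT_0).
  assert (Hn : 3 <= INR n) by (apply le_INR in hn; simpl in hn; lra).
  assert (Hr : 0 < INR r).
  { pose proof (pos_INR r) as H; destruct H as [H | H]; [exact H | ].
    rewrite <- H in *; lra. }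
  set (q := (INR n - 2) / 3); assert (Hq : 0 < q) by (unfold q; lra).
  set (k := sqrt rho); assert (Hk : 0 < k) by (apply sqrt_lt_R0, hrho).
  assert (Hrho : rho = k ^ 2) by (unfold k; rewrite pow2_sqrt; lra).
  assert (Hp : (INR n - 2) / (INR n + 1) = q / (1 + q)) by (unfold q; field; lra).
  (* After r oscillations this increment totals 2 pi l; the two inequalities on l and r say exactly
     that it lies between pi and sqrt 2 * pi. *)
  set (x := 2 * PI * INR l / INR r).
  assert (Hx : PI < x < sqrt 2 * PI).
  { unfold x; split; apply Rmult_lt_reg_r with (INR r); try exact Hr.
    - replace (2 * PI * INR l / INR r * INR r) with (PI * (2 * INR l)) by (field; lra).
      apply Rmult_lt_compat_l; lra.
    - replace (2 * PI * INR l / INR r * INR r) with (PI * (2 * INR l)) by (field; lra).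
      replace (sqrt 2 * PI * INR r) with (PI * (sqrt 2 * INR r)) by ring.
      apply Rmult_lt_compat_l; lra. }
  destruct (closed_motion_exists q k x Hq Hk Hx)
    as (B & M & T & HB & HT & Hth0 & Hnc & Hper & Hmin).
  rewrite Hp, Hrho; clearbody k; clear rho hrho Hrho Hp.
  pose proof (curvature_Rpower Hq Hk HB M) as Hkv; cbv zeta in Hkv.
  set (p := q / (1 + q)) in *.
  assert (Hc0 : 0 < Rpower (k * sqrt q) (p - 1)) by apply exp_pos.
  (* kappa^(p-1) is a positive multiple of v, so a period of the curvature is a period of v. *)
  assert (Hper_v : forall T',
    (forall s, geodesic_curvature (k ^ 2) (motion_curve M) (s + T')
      = geodesic_curvature (k ^ 2) (motion_curve M) s) -> forall s, mv M (s + T') = mv M s).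
  { intros T' E s; apply Rmult_eq_reg_l with (Rpower (k * sqrt q) (p - 1)); [ | lra].
    rewrite <- !Hkv, E; reflexivity. }
  pose proof (quasi_periodic_iter (mth M) T x (fun s => proj2 (proj2 (proj2 (Hper s))))) as Hth.
  assert (Hiter : forall m s, mv M (s + INR m * T) = mv M s /\ ma M (s + INR m * T) = ma M s /\
    mz M (s + INR m * T) = mz M s).
  { intros m s; repeat split.
    - rewrite (quasi_periodic_iter (mv M) T 0); [ring | intro t; rewrite (proj1 (Hper t)); ring].
    - rewrite (quasi_periodic_iter (ma M) T 0);
        [ring | intro t; rewrite (proj1 (proj2 (Hper t))); ring].
    - rewrite (quasi_periodic_iter (mz M) T 0);
        [ring | intro t; rewrite (proj1 (proj2 (proj2 (Hper t)))); ring]. }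
  exists (motion_curve M), (INR r * T).
  split; [exact (motion_curve_p_elastic Hq Hk HB M) | ].
  split.
  { destruct Hnc as (s & Hs); exists s, 0; intro E; apply Hs.
    apply Rmult_eq_reg_l with (Rpower (k * sqrt q) (p - 1)); [ | lra].
    rewrite <- !Hkv, E; reflexivity. }
  split; [exact (motion_curve_in_pole_coordinates Hq Hk HB M) | ].
  assert (Hrx : INR r * x = 2 * INR l * PI) by (unfold x; field; lra).
  split; [ | split].
  - split; [split | ].
    + apply Rmult_lt_0_compat; assumption.
    + intro s; unfold motion_curve.
      destruct (Hiter r s) as (-> & -> & ->); rewrite Hth, Hrx, cos_period, sin_period; reflexivity.
    + intros T' (HT' & HgT).
      assert (HvT : forall s, mv M (s + T') = mv M s).
      { intro s; pose proof (f_equal (fun y => fst (fst y)) (HgT s)) as E.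
        unfold motion_curve in E; simpl in E.
        apply Rmult_eq_reg_r with (/ (k * B)); [exact E | ].
        apply Rinv_neq_0_compat, Rgt_not_eq, Rmult_lt_0_compat; assumption. }
      destruct (Hmin T' HT' HvT) as (m & Hm & ->).
      (* At time m T the pair (a, z) is rotated by m x from its initial direction; closure makes the
         two agree, and their scalar product isolates the cosine. Then m l = r j, and coprimality
         gives r | m. *)
      assert (Hc1 : cos (INR m * x) = 1).
      { pose proof (HgT 0) as E; unfold motion_curve in E.
        destruct (Hiter m 0) as (E1 & E2 & E3); rewrite E1, E2, E3, Hth, Hth0 in E.
        rewrite Rplus_0_l, cos_0, sin_0 in E; injection E as F1 F2.
        pose proof (mz_pos _ _ _ M 0) as Hz.
        assert (HkB : 0 < k * B) by (apply Rmult_lt_0_compat; assumption).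
        apply Rmult_eq_reg_r in F1; [ | apply Rinv_neq_0_compat; lra].
        apply Rmult_eq_reg_r in F2; [ | apply Rinv_neq_0_compat; lra].
        assert (Hs0 : 0 < ma M 0 ^ 2 + mz M 0 ^ 2) by nra.
        apply Rmult_eq_reg_l with (ma M 0 ^ 2 + mz M 0 ^ 2); [ | lra].
        replace ((ma M 0 ^ 2 + mz M 0 ^ 2) * cos (INR m * x))
          with (ma M 0 * (ma M 0 * cos (INR m * x) - mz M 0 * sin (INR m * x))
            + mz M 0 * (ma M 0 * sin (INR m * x) + mz M 0 * cos (INR m * x))) by ring.
        rewrite F1, F2; ring. }
      destruct (cos_eq_1 _ Hc1) as (j & Hj).
      assert (Hml : INR (m * l) = INR r * IZR j).
      { rewrite mult_INR; apply Rmult_eq_reg_l with (2 * PI); [ | lra].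
        replace (2 * PI * (INR m * INR l)) with (INR m * (INR r * x)) by (rewrite Hrx; ring).
        replace (INR m * (INR r * x)) with (INR r * (INR m * x)) by ring.
        rewrite Hj; ring. }
      assert (Hdiv : Nat.divide r (l * m)).
      { rewrite !INR_IZR_INZ, <- mult_IZR in Hml; apply eq_IZR in Hml.
        assert (Hj0 : (0 <= j)%Z).
        { assert (Hr' : (0 < Z.of_nat r)%Z) by (apply lt_IZR; rewrite <- INR_IZR_INZ; exact Hr).
          nia. }
        exists (Z.to_nat j); nia. }
      assert (Hrm : (r <= m)%nat).
      { apply Nat.divide_pos_le; [lia | ].
        apply Nat.gauss with l; [exact Hdiv | rewrite Nat.gcd_comm; exact hlr]. }
      apply Rmult_le_compat_r; [lra | apply le_INR, Hrm].
  - exists (Z.of_nat l); split; [lia | ].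
    destruct (Hiter r 0) as (_ & E2 & E3); pose proof (Hth r 0) as E4.
    rewrite !Rplus_0_l in *.
    apply motion_curve_winding; auto.
    rewrite E4, Hrx, INR_IZR_INZ; ring.
  - exists T; split; [split; [split | ] | reflexivity].
    + exact HT.
    + intro s; rewrite !(motion_curve_curvature Hk HB).
      destruct (Hper s) as (-> & _ & -> & _); reflexivity.
    + intros T' (HT' & HkT).
      destruct (Hmin T' HT' (Hper_v T' HkT)) as (m & Hm & ->).
      apply le_INR in Hm; simpl in Hm; nra.
Qed.
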